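(* Let $\mathcal H$ be a Hilbert space of finite dimension $d$, let $0\le p\le\frac{d^2}{d^2-1}$, and let $\Phi$ be the depolarizing channel $\Phi(\sigma)=(1-p)\sigma+\frac pdI_{\mathcal H}$ on $\mathfrak S(\mathcal H)$. Let $\mathcal K$ be a finite-dimensional Hilbert space. Then for every quantum channel $\Omega:\mathfrak S(\mathcal K)\to\mathfrak S(\mathcal K)$ and every $\rho\in\mathfrak S(\mathcal H\otimes\mathcal K)$, $$H_{\Phi\otimes\Omega}(\rho)\ge H_\Phi(\mathrm{Tr}_{\mathcal K}(\rho))+H_\Omega(\mathrm{Tr}_{\mathcal H}(\rho)).$$
   Context: $\mathfrak S(\cdot)$ denotes the set of density operators; a quantum channel is a completely positive trace-preserving linear map; $S(\sigma)=-\mathrm{Tr}(\sigma\log\sigma)$ is the von Neumann entropy. For a channel $\Psi$ with input space $\mathcal L$ and $\sigma\in\mathfrak S(\mathcal L)$, $H_\Psi(\sigma):=\min\sum_{j}\pi_jS(\Psi(\sigma_j))$, the minimum over all finite decompositions $\sigma=\sum_j\pi_j\sigma_j$ with $\{\pi_j\}$ a probability distribution and $\sigma_j\in\mathfrak S(\mathcal L)$. *)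

(* Defs.v *)
From HB Require Import structures.
From mathcomp Require Import all_boot all_order all_algebra.
From mathcomp Require Import complex mxtens.
From mathcomp Require Import boolp classical_sets reals exp.
Set Implicit Arguments.
Unset Strict Implicit.
Unset Printing Implicit Defensive.
Import Order.TTheory GRing.Theory Num.Theory Num.Def.
Local Open Scope ring_scope.
Local Open Scope classical_set_scope.

Section Quantum.
Variable R : realType.
Local Notation C := (R[i]).

Definition RtoC (x : R) : C := Complex x 0.

Definition adjmx m n (M : 'M[C]_(m, n)) : 'M[C]_(n, m) := (map_mx conjC M)^T.

Definition psd n (A : 'M[C]_n) : Prop :=
  forall v : 'rV[C]_n, 0 <= (v *m A *m adjmx v) 0 0.

Definition density n (A : 'M[C]_n) : Prop := psd A /\ \tr A = 1.

Definition linear_map n m (Phi : 'M[C]_n -> 'M[C]_m) : Prop :=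
  forall (a : C) (A B : 'M[C]_n), Phi (a *: A + B) = a *: Phi A + Phi B.

(* tensor product Phi (x) Psi of two maps (extended linearly from the
   product basis E_ij (x) E_ab); the tensor index ordering is mxtens_index. *)
Definition tensor_map n1 m1 n2 m2
  (Phi : 'M[C]_n1 -> 'M[C]_m1) (Psi : 'M[C]_n2 -> 'M[C]_m2)
  (X : 'M[C]_(n1 * n2)) : 'M[C]_(m1 * m2) :=
  \sum_(i < n1) \sum_(j < n1) \sum_(a < n2) \sum_(b < n2)
     X (mxtens_index (i, a)) (mxtens_index (j, b)) *:
       (Phi (delta_mx i j) *t Psi (delta_mx a b)).

Definition completely_positive n m (Phi : 'M[C]_n -> 'M[C]_m) : Prop :=
  forall (r : nat) (X : 'M[C]_(r * n)),
    psd X -> psd (tensor_map (@id 'M[C]_r) Phi X).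

Definition trace_preserving n m (Phi : 'M[C]_n -> 'M[C]_m) : Prop :=
  forall A : 'M[C]_n, \tr (Phi A) = \tr A.

Definition channel n m (Phi : 'M[C]_n -> 'M[C]_m) : Prop :=
  [/\ linear_map Phi, completely_positive Phi & trace_preserving Phi].

Definition ptrace2 n1 n2 (X : 'M[C]_(n1 * n2)) : 'M[C]_n1 :=
  \matrix_(i, j) \sum_(a < n2) X (mxtens_index (i, a)) (mxtens_index (j, a)).
Definition ptrace1 n1 n2 (X : 'M[C]_(n1 * n2)) : 'M[C]_n2 :=
  \matrix_(a, b) \sum_(i < n1) X (mxtens_index (i, a)) (mxtens_index (i, b)).

(* von Neumann entropy S(s) = - Tr (s log s) = - sum_i l_i ln l_i, where
   l_i are the eigenvalues (with multiplicity) from the spectral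
   decomposition s = U^-1 diag(l) U (spectral.v); 0 ln 0 = 0 since ln 0 = 0. *)
Definition eigval n (s : 'M[C]_n) (i : 'I_n) : R :=
  complex.Re (spectral_diag s 0 i).

Definition vN_entropy n (s : 'M[C]_n) : R :=
  - \sum_(i < n) (eigval s i * ln (eigval s i)).

(* H_Psi(s) := min over finite decompositions s = sum_j pi_j s_j of
   sum_j pi_j S(Psi(s_j)); formalized as the infimum of that set of values
   (which is attained, so equals the minimum). *)
Definition out_entropy_values n m (Psi : 'M[C]_n -> 'M[C]_m) (s : 'M[C]_n)
  : set R :=
  [set x | exists (J : nat) (pi : 'I_J -> R) (ss : 'I_J -> 'M[C]_n),
      [/\ (forall j, 0 <= pi j), \sum_(j < J) pi j = 1,
          (forall j, density (ss j)),
          s = \sum_(j < J) RtoC (pi j) *: ss j &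
          x = \sum_(j < J) pi j * vN_entropy (Psi (ss j))]].

Definition H_chan n m (Psi : 'M[C]_n -> 'M[C]_m) (s : 'M[C]_n) : R :=
  inf (out_entropy_values Psi s).

(* depolarizing channel on C^d, extended linearly to all operators:
   Phi(s) = (1 - p) s + p Tr(s)/d I  (= (1-p) s + p/d I on states) *)
Definition depolarizing (d : nat) (p : R) (s : 'M[C]_d) : 'M[C]_d :=
  RtoC (1 - p) *: s + (RtoC (p / d%:R) * \tr s) *: 1%:M.

End Quantum.
Arguments depolarizing {R} d p s.

(* Main.v *)
(* The minimal output entropy of the depolarizing channel Phi is the entropy
   H(c) of the spectrum c of Phi(pure state), and H_Phi <= H(c). By convexity it
   is enough to decompose Tr_H rho, for each state rho, as a mixture of states
   tau_t with weights q_t such that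
     S((Phi (x) Omega) rho) >= H(c) + sum_t q_t S(Omega tau_t).
   In a basis b_i of H unbiased with an eigenbasis of Tr_K rho, consider the
   phase damping map sigma |-> lam sigma + (1 - lam) sum_i P_i sigma P_i with
   lam = 1 - p. Its Gram matrix lam + (1 - lam) [i = j] is that of vectors m_i,
   and its output on sigma = A A^* = (id (x) Omega) rho has the nonzero spectrum
   of sum_i m_i m_i^* (x) A_i^* A_i, where A_i = <b_i| A. Monotonicity of the
   relative entropy under the preparation |i><i| |-> m_i m_i^* bounds its entropy
   below by H(c) + (1/d) sum_i S(d <b_i| sigma |b_i>), and
   <b_i| sigma |b_i> = Omega <b_i| rho |b_i>. As King observed, Phi is a mixture
   of such maps followed by diagonal unitaries, exactly when Phi is completely
   positive, so concavity of the entropy concludes.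
   Monotonicity is obtained from the resolvent representation of the logarithm:
   each resolvent term is the maximum of a quadratic form that is affine in the
   pair of operators, hence can be compressed by isometries. *)
Require Import Defs.
From HB Require Import structures.
From mathcomp Require Import all_boot all_order all_algebra.
From mathcomp Require Import complex mxtens spectral perm separable cyclic.
From mathcomp Require Import ring.
From mathcomp Require Import boolp classical_sets reals exp.
From mathcomp Require cyclotomic topology normedtype derive realfun.
Import Order.TTheory GRing.Theory Num.Theory Num.Def.
Set Implicit Arguments.
Unset Strict Implicit.
Unset Printing Implicit Defensive.
Local Open Scope ring_scope.

(** * Comparison of sums of logarithms *)

Section LnComparison.
Import topology normedtype derive realfun numFieldNormedType.Exports.
Variable R : realType.

Lemma is_derive_sum_ln (T : Type) (r : seq T) (a x : T -> R) (t : R) :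
  0 <= t -> (forall k, 0 < x k) ->
  is_derive t 1 (fun t => \sum_(k <- r) a k * ln (x k + t))
    (\sum_(k <- r) a k / (x k + t)).
Proof.
move=> t0 x0; elim: r => [|k r IH].
  rewrite big_nil.
  have -> : (fun t => \sum_(k <- [::]) a k * ln (x k + t)) = (fun=> 0).
    by apply/funext => s; rewrite big_nil.
  exact: is_derive_cst.
rewrite big_cons.
have xt : 0 < x k + t by rewrite ltr_wpDr.
have D0 : is_derive t 1 (fun s => x k + s) (0 + 1).
  exact: (@is_deriveD R R R (fun=> x k) id t 1 0 1).
have D1 := @is_derive1_comp R (@ln R) _ t _ _ (is_derive1_ln xt) D0.
have D2 := @is_deriveD R R R _ _ t 1 _ _ (@is_deriveZ R R R _ (a k) t 1 _ D1) IH.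
move: D2; rewrite add0r mulr1.
congr (is_derive _ _ _ _); apply/funext => s; by rewrite big_cons.
Qed.

(* [G t = \sum_k a k * ln (x k + t)] is nondecreasing, and it is [O(1/t)] at
   infinity because the weights cancel. *)
Lemma sum_ln_le0 (T : finType) (a x : T -> R) :
  (forall k, 0 < x k) -> \sum_k a k = 0 ->
  (forall t : R, 0 < t -> 0 <= \sum_k a k / (x k + t)) ->
  \sum_k a k * ln (x k) <= 0.
Proof.
move=> x0 sa0 H.
pose G (t : R) := \sum_k a k * ln (x k + t).
have Gd (t : R) : 0 <= t -> @is_derive R R R t 1 G (\sum_k a k / (x k + t)).
  by move=> t0; apply: is_derive_sum_ln.
(* The constant of the [O(1/t)] bound: [ln (1 + x / t) <= x / t] termwise, with absolute values
   absorbing the signs of the weights. *)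
pose C := \sum_k `|a k| * x k.
have C0 : 0 <= C by apply: sumr_ge0 => k _; rewrite mulr_ge0 // ltW.
have GC (t : R) : 0 < t -> G 0 <= C / t.
  move=> t0; apply: (@le_trans _ _ (G t)).
    apply: (@ger0_derive1_le_cc R G 0 t) => //; last exact: ltW.
    - move=> s; rewrite in_itv /= => /andP[s0 _].
      exact: (@ex_derive _ _ _ _ _ _ _ (Gd s (ltW s0))).
    - move=> s; rewrite in_itv /= => /andP[s0 _].
      rewrite derive1E (@derive_val _ _ _ _ _ _ _ (Gd s (ltW s0))).
      exact: H.
    - apply: derivable_within_continuous => s; rewrite in_itv /= => /andP[s0 _].
      exact: (@ex_derive _ _ _ _ _ _ _ (Gd s s0)).
    - by rewrite in_itv /= lexx ltW.
    - by rewrite in_itv /= lexx ltW.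
  have -> : G t = \sum_k a k * ln (1 + x k / t).
    have -> : \sum_k a k * ln (1 + x k / t) = \sum_k a k * (ln (x k + t) - ln t).
      apply: eq_bigr => k _; rewrite -ln_div ?posrE ?addr_gt0 //.
      by congr (_ * ln _); field; rewrite gt_eqF.
    under [RHS]eq_bigr do rewrite mulrBr.
    by rewrite sumrB -mulr_suml sa0 mul0r subr0.
  rewrite /C mulr_suml; apply: ler_sum => k _.
  have q0 : 0 < x k / t by rewrite divr_gt0.
  apply: (le_trans (ler_norm _)); rewrite normrM -mulrA ler_wpM2l //.
  rewrite ger0_norm ?ln_ge0 ?lerDl ?(ltW q0) //.
  by apply: le_ln1Dx; rewrite (lt_trans _ q0) // oppr_lt0.
have -> : \sum_k a k * ln (x k) = G 0 by apply: eq_bigr => k _; rewrite addr0.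
rewrite leNgt; apply/negP => G0.
(* If [G 0 > 0], this choice of [t] turns the bound into [G 0 <= G 0 * C / (C + 1)], a
   contradiction. *)
have := GC ((C + 1) / G 0) (divr_gt0 (ltr_wpDl C0 ltr01) G0).
rewrite invf_div mulrCA ler_pMr // ler_pdivlMr ?ltr_wpDl // mul1r.
by rewrite gerDl leNgt ltr01.
Qed.

(** Since [ln x] is the integral over [t > 0] of [1 / (1 + t) - 1 / (x + t)], an inequality between
    resolvent sums of equal total weight passes to logarithms with its direction reversed. *)
Lemma ln_majorization (I J : finType) (w x : I -> R) (w' y : J -> R) :
  (forall i, w i != 0 -> 0 < x i) -> (forall j, w' j != 0 -> 0 < y j) ->
  \sum_i w i = \sum_j w' j ->
  (forall t : R, 0 < t -> \sum_i w i / (x i + t) <= \sum_j w' j / (y j + t)) ->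
  \sum_j w' j * ln (y j) <= \sum_i w i * ln (x i).
Proof.
(* Points of weight zero, which may come from zero eigenvalues, are moved to [1] so that every
   argument is positive. *)
move=> x0 y0 sw H.
pose x1 i := if w i == 0 then 1 else x i.
pose y1 j := if w' j == 0 then 1 else y j.
pose a (k : I + J) := match k with inl i => - w i | inr j => w' j end.
pose z (k : I + J) := match k with inl i => x1 i | inr j => y1 j end.
have wx (f : R -> R) i : w i * f (x1 i) = w i * f (x i).
  by rewrite /x1; case: eqP => // ->; rewrite !mul0r.
have wy (f : R -> R) j : w' j * f (y1 j) = w' j * f (y j).
  by rewrite /y1; case: eqP => // ->; rewrite !mul0r.
have := @sum_ln_le0 (I + J)%type a z; rewrite !big_sumType /=.
rewrite [X in X + _ <= 0](_ : _ = - \sum_i w i * ln (x i)); last first.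
  by rewrite -sumrN; apply: eq_bigr => i _; rewrite mulNr wx.
rewrite [X in _ + X <= 0](_ : _ = \sum_j w' j * ln (y j)); last first.
  by apply: eq_bigr => j _; rewrite wy.
rewrite [X in X <= 0]addrC subr_le0; apply.
- case=> [i|j] /=; rewrite ?/x1 ?/y1; case: ifPn => // ?; [exact: x0|exact: y0].
- by rewrite sumrN sw addNr.
- move=> t t0; rewrite big_sumType /= addrC.
  under eq_bigr do rewrite (wy (fun s => (s + t)^-1)).
  under [X in _ + X]eq_bigr do rewrite mulNr (wx (fun s => (s + t)^-1)).
  by rewrite sumrN subr_ge0; exact: H.
Qed.

End LnComparison.

(** * Positive semidefinite matrices *)

HB.instance Definition _ (R : realType) :=
  GRing.RMorphism.copy (@RtoC R) (real_complex R).

Section Matrices.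
Variable R : realType.
Local Notation C := (R[i]).

Lemma RtoC_le (x y : R) : (RtoC x <= RtoC y) = (x <= y).
Proof. exact: lecR. Qed.

Lemma RtoC_ge0 (x : R) : (0 <= RtoC x) = (0 <= x).
Proof. exact: (lecR 0). Qed.

Lemma RtoC_inj : injective (@RtoC R).
Proof. exact: complexI. Qed.

Lemma RtoC_sum I (r : seq I) (P : pred I) (F : I -> R) :
  RtoC (\sum_(i <- r | P i) F i) = \sum_(i <- r | P i) RtoC (F i).
Proof. exact: (rmorph_sum (@RtoC R)). Qed.

Lemma RtoCM (x y : R) : RtoC (x * y) = RtoC x * RtoC y.
Proof. exact: (rmorphM (@RtoC R)). Qed.

Lemma RtoCD (x y : R) : RtoC (x + y) = RtoC x + RtoC y.
Proof. exact: (rmorphD (@RtoC R)). Qed.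

Lemma RtoCB (x y : R) : RtoC (x - y) = RtoC x - RtoC y.
Proof. exact: (rmorphB (@RtoC R)). Qed.

Lemma RtoCV (x : R) : RtoC x^-1 = (RtoC x)^-1.
Proof. exact: (fmorphV (@RtoC R)). Qed.

Lemma RtoC0 : RtoC (0 : R) = 0.
Proof. by []. Qed.

Lemma RtoC1 : RtoC (1 : R) = 1.
Proof. by []. Qed.

Lemma conj_RtoC (x : R) : (RtoC x)^* = RtoC x.
Proof. by apply/CrealP; apply/complex_realP; exists x. Qed.

Lemma ge0_RtoC (z : C) : 0 <= z -> z = RtoC (complex.Re z).
Proof. by case: z => a b; rewrite lecE /= => /andP[/eqP ->]. Qed.

Definition sqnorm (z : C) : R := complex.Re (z * z^*).

Lemma sqnormE (z : C) : RtoC (sqnorm z) = z * z^*.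
Proof. by rewrite -ge0_RtoC // mul_conjC_ge0. Qed.

Lemma sqnorm_ge0 z : 0 <= sqnorm z.
Proof. by rewrite -RtoC_ge0 sqnormE mul_conjC_ge0. Qed.

Lemma sqnorm_eq0 z : (sqnorm z == 0) = (z == 0).
Proof. by rewrite -(inj_eq RtoC_inj) sqnormE RtoC0 mul_conjC_eq0. Qed.

Lemma adjmxE m n (A : 'M[C]_(m, n)) i j : adjmx A i j = (A j i)^*.
Proof. by rewrite /adjmx !mxE. Qed.

Lemma adjmxK m n (A : 'M[C]_(m, n)) : adjmx (adjmx A) = A.
Proof. by apply/matrixP => i j; rewrite !adjmxE conjCK. Qed.

Lemma adjmx_mul m n p (A : 'M[C]_(m, n)) (B : 'M[C]_(n, p)) :
  adjmx (A *m B) = adjmx B *m adjmx A.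
Proof. by rewrite /adjmx map_mxM trmx_mul. Qed.

Lemma adjmxD m n (A B : 'M[C]_(m, n)) : adjmx (A + B) = adjmx A + adjmx B.
Proof. by apply/matrixP => i j; rewrite adjmxE !mxE rmorphD. Qed.

Lemma adjmxB m n (A B : 'M[C]_(m, n)) : adjmx (A - B) = adjmx A - adjmx B.
Proof. by apply/matrixP => i j; rewrite adjmxE !mxE rmorphB. Qed.

Lemma adjmxZ m n a (A : 'M[C]_(m, n)) : adjmx (a *: A) = a^* *: adjmx A.
Proof. by apply/matrixP => i j; rewrite adjmxE !mxE rmorphM. Qed.

Lemma adjmx1 n : adjmx (1%:M : 'M[C]_n) = 1%:M.
Proof. by apply/matrixP => i j; rewrite adjmxE !mxE eq_sym rmorph_nat. Qed.

Lemma adjmx_diag n (l : 'I_n -> R) :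
  adjmx (diag_mx (\row_i RtoC (l i))) = diag_mx (\row_i RtoC (l i)).
Proof.
apply/matrixP => i j; rewrite adjmxE !mxE eq_sym; case: eqP => [->|_].
  by rewrite !mulr1n conj_RtoC.
by rewrite !mulr0n rmorph0.
Qed.

Lemma mulmx_adj_diag m n (A : 'M[C]_(m, n)) i :
  (A *m adjmx A) i i = RtoC (\sum_j sqnorm (A i j)).
Proof.
by rewrite mxE RtoC_sum; apply: eq_bigr => j _; rewrite adjmxE sqnormE.
Qed.

Lemma adj_mulmx_diag m n (A : 'M[C]_(m, n)) j :
  (adjmx A *m A) j j = RtoC (\sum_i sqnorm (A i j)).
Proof.
rewrite mxE RtoC_sum; apply: eq_bigr => i _.
by rewrite adjmxE sqnormE mulrC.
Qed.

Lemma psd_mul_adj m n (B : 'M[C]_(m, n)) : psd (B *m adjmx B).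
Proof.
move=> v; rewrite mulmxA -mulmxA -adjmx_mul mulmx_adj_diag RtoC_ge0.
by apply: sumr_ge0 => j _; exact: sqnorm_ge0.
Qed.

Lemma psd_conj m n (A : 'M[C]_n) (B : 'M[C]_(m, n)) :
  psd A -> psd (B *m A *m adjmx B).
Proof.
move=> hA v; have := hA (v *m B).
by rewrite adjmx_mul !mulmxA.
Qed.

Lemma psd_diag_ge0 n (A : 'M[C]_n) i : psd A -> 0 <= A i i.
Proof.
move=> /(_ (delta_mx 0 i)).
rewrite -rowE /adjmx map_delta_mx trmx_delta -[_ *m _]colE.
by rewrite !mxE.
Qed.

Lemma psd_trace_ge0 n (A : 'M[C]_n) : psd A -> 0 <= \tr A.
Proof. by move=> hA; apply: sumr_ge0 => i _; exact: psd_diag_ge0. Qed.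

Lemma psd0 n : psd (0 : 'M[C]_n).
Proof. by move=> v; rewrite mulmx0 mul0mx mxE. Qed.

Lemma psdD n (A B : 'M[C]_n) : psd A -> psd B -> psd (A + B).
Proof. by move=> hA hB v; rewrite mulmxDr mulmxDl mxE addr_ge0. Qed.

Lemma psdZ n (a : C) (A : 'M[C]_n) : 0 <= a -> psd A -> psd (a *: A).
Proof. by move=> ha hA v; rewrite -scalemxAr -scalemxAl mxE mulr_ge0. Qed.

Lemma psd_sum n (I : finType) (F : I -> 'M[C]_n) :
  (forall i, psd (F i)) -> psd (\sum_i F i).
Proof. by move=> hF; elim/big_rec: _ => [|i A _]; [exact: psd0|exact: psdD]. Qed.

(* Polarization with the test vectors e_i + z e_j for z = 1 and z = 'i. *)
Lemma psd_adj n (A : 'M[C]_n) : psd A -> adjmx A = A.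
Proof.
move=> hA.
have q (i j : 'I_n) (z : C) :
    0 <= A i i + z^* * A i j + z * A j i + z * z^* * A j j.
  have := hA (delta_mx 0 i + z *: delta_mx 0 j).
  rewrite adjmxD adjmxZ /adjmx !map_delta_mx !trmx_delta !mulmxDl !mulmxDr.
  rewrite -?scalemxAl -?scalemxAr -?scalemxAl -?rowE -?colE !mxE.
  by congr (0 <= _); ring.
have real_ge0 (a : C) : 0 <= a -> a^* = a by move=> /ger0_real/CrealP.
apply/matrixP => i j; rewrite adjmxE.
have /real_ge0 := q i j 1; have /real_ge0 := q i j 'i.
rewrite !rmorphD !rmorphM. rewrite /= !conjCK conjCi rmorph1.
rewrite (real_ge0 _ (psd_diag_ge0 i hA)) (real_ge0 _ (psd_diag_ge0 j hA)).
move=> e1 e2.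
have i2 : 'i * 'i = -1 :> C by rewrite -expr2 sqrCi.
have e3 : 'i * ('i * (A i j)^* - 'i * (A j i)^*) = 'i * ('i * A j i - 'i * A i j).
  congr (_ * _); apply/eqP; rewrite -subr_eq0; apply/eqP.
  transitivity (('i * (A i j)^* - 'i * (A j i)^*) - ('i * A j i - 'i * A i j)) => //.
  move/eqP: e1; rewrite -subr_eq0 => /eqP <-; ring.
move: e3; rewrite !mulrBr !mulrA !i2 !mulN1r => e3.
have e4 : (A i j)^* + (A j i)^* = A i j + A j i.
  move/eqP: e2; rewrite -subr_eq0 => /eqP e2; apply/eqP; rewrite -subr_eq0.
  by apply/eqP; rewrite -e2; ring.
have : 2%:R * ((A j i)^* - A i j) = 0.
  transitivity (((A i j)^* + (A j i)^* - (A i j + A j i)) +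
    ((- (A i j)^* - - (A j i)^*) - (- A j i - - A i j))); first ring.
  by rewrite e3 e4; ring.
by move/eqP; rewrite mulf_eq0 pnatr_eq0 /= subr_eq0 => /eqP.
Qed.

End Matrices.

(** * Entropy and spectral decompositions *)

Section Entropy.
Variable R : realType.
Local Notation C := (R[i]).

Definition real_diag n (l : 'I_n -> R) : 'M[C]_n := diag_mx (\row_i RtoC (l i)).

(** Any unitary [U] and any order of the eigenvalues are allowed, whereas [eigval] belongs to one
    chosen diagonalisation. The eigenvectors are the adjoints of the rows of [U]. *)
Definition eigdec n (A U : 'M[C]_n) (l : 'I_n -> R) : Prop :=
  U *m adjmx U = 1%:M /\ A = adjmx U *m real_diag l *m U.

Definition shannon (I : finType) (l : I -> R) : R := - \sum_i l i * ln (l i).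

Lemma real_diagE n (l : 'I_n -> R) i j :
  real_diag l i j = RtoC (l i) *+ (i == j).
Proof. by rewrite /real_diag !mxE. Qed.

Lemma adj_real_diag n (l : 'I_n -> R) : adjmx (real_diag l) = real_diag l.
Proof. exact: adjmx_diag. Qed.

Lemma mulmx_real_diagE m n (A : 'M[C]_(m, n)) l i j :
  (A *m real_diag l) i j = A i j * RtoC (l j).
Proof. by rewrite /real_diag mul_mx_diag !mxE. Qed.

Lemma real_diag_mulmxE m n (A : 'M[C]_(m, n)) l i j :
  (real_diag l *m A) i j = RtoC (l i) * A i j.
Proof. by rewrite /real_diag mul_diag_mx !mxE. Qed.

Lemma eigdec_diag n (A U : 'M[C]_n) l :
  eigdec A U l -> U *m A *m adjmx U = real_diag l.
Proof.
by case=> hU ->; rewrite !mulmxA hU mul1mx -mulmxA hU mulmx1.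
Qed.

Lemma eigdec_trace n (A U : 'M[C]_n) l :
  eigdec A U l -> \tr A = RtoC (\sum_i l i).
Proof.
case=> hU ->; rewrite mxtrace_mulC mulmxA hU mul1mx RtoC_sum.
by apply: eq_bigr => i _; rewrite real_diagE eqxx mulr1n.
Qed.

Lemma real_diag_sqr n (l : 'I_n -> R) : (forall i, 0 <= l i) ->
  real_diag (fun i => sqrtr (l i)) *m real_diag (fun i => sqrtr (l i)) =
  real_diag l.
Proof.
move=> l0; apply/matrixP => i j; rewrite mulmx_real_diagE !real_diagE.
case: eqP => [->|_]; last by rewrite !mulr0n mul0r.
by rewrite !mulr1n -RtoCM -expr2 sqr_sqrtr.
Qed.

Lemma eigdec_psd n (A U : 'M[C]_n) l :
  eigdec A U l -> (forall i, 0 <= l i) -> psd A.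
Proof.
case=> _ -> l0; rewrite -(real_diag_sqr l0) !mulmxA -[X in psd X]mulmxA.
have := psd_mul_adj (adjmx U *m real_diag (fun i => sqrtr (l i))).
by rewrite adjmx_mul adj_real_diag adjmxK.
Qed.

Lemma psd_eigdec n (A : 'M[C]_n) : psd A ->
  eigdec A (spectralmx A) (eigval A) /\ (forall i, 0 <= eigval A i).
Proof.
move=> hA; have hadj := psd_adj hA.
have adjE m p (M : 'M[C]_(m, p)) : map_mx conjC M^T = adjmx M.
  by rewrite /adjmx map_trmx.
have hn : A \is normalmx by apply/normalmxP; rewrite adjE hadj.
have hu := spectral_unitarymx A.
have hU : spectralmx A *m adjmx (spectralmx A) = 1%:M.
  by rewrite -adjE; exact/unitarymxP.
have /orthomx_spectralP hdec := hn.
have hI : invmx (spectralmx A) = adjmx (spectralmx A).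
  by rewrite -adjE; exact: invmx_unitary.
rewrite hI in hdec.
have d0 i : 0 <= spectral_diag A 0 i.
  have := psd_diag_ge0 i (psd_conj (spectralmx A) hA).
  move: hU hdec; set U := spectralmx A; set D := spectral_diag A => hU hdec.
  rewrite hdec !mulmxA hU mul1mx -mulmxA hU mulmx1.
  by rewrite !mxE eqxx mulr1n.
have hd i : spectral_diag A 0 i = RtoC (eigval A i) by rewrite -ge0_RtoC.
have hD : diag_mx (spectral_diag A) = real_diag (eigval A).
  by congr diag_mx; apply/rowP => i; rewrite hd mxE.
split; last by move=> i; rewrite -RtoC_ge0 -hd.
split; [exact: hU|by rewrite -hD].
Qed.

Lemma psd_sqrt n (A : 'M[C]_n) : psd A -> exists B : 'M[C]_n, A = B *m adjmx B.
Proof.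
move=> /psd_eigdec[[_ hA] l0].
exists (adjmx (spectralmx A) *m real_diag (fun i => sqrtr (eigval A i))).
rewrite adjmx_mul adj_real_diag adjmxK mulmxA -[X in X *m _]mulmxA.
by rewrite real_diag_sqr.
Qed.

(* With [c = U K V^*], the entries satisfy [xi x * c x y = eta y * c x y], so
   both sums equal the double sum of [|c x y|^2 ln (xi x)]. *)
Lemma eigdec_swap m n (K : 'M[C]_(m, n)) U xi V eta :
  eigdec (K *m adjmx K) U xi -> eigdec (adjmx K *m K) V eta ->
  shannon xi = shannon eta.
Proof.
move=> hX hY; pose c := U *m K *m adjmx V.
have [hU _] := hX; have [hV _] := hY.
have hV' := mulmx1C hV; have hU' := mulmx1C hU.
have e1 : c *m adjmx c = real_diag xi.
  rewrite -(eigdec_diag hX) /c !adjmx_mul adjmxK !mulmxA.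
  by rewrite -[X in X *m _ *m _]mulmxA hV' mulmx1.
have e2 : adjmx c *m c = real_diag eta.
  rewrite -(eigdec_diag hY) /c !adjmx_mul adjmxK !mulmxA.
  by rewrite -[X in X *m _ *m _]mulmxA hU' mulmx1.
(* Entry [(x, y)] of [c c^* c], bracketed in the two possible ways. *)
have exy x y : xi x * sqnorm (c x y) = eta y * sqnorm (c x y).
  apply: (@RtoC_inj R); rewrite !RtoCM sqnormE !mulrA; congr (_ * _).
  have := congr1 (fun M : 'M_(m, n) => M x y) (mulmxA c (adjmx c) c).
  by rewrite e1 e2 /= mulmx_real_diagE real_diag_mulmxE mulrC.
have sx x : xi x = \sum_y sqnorm (c x y).
  apply: (@RtoC_inj R); rewrite -mulmx_adj_diag e1.
  by rewrite real_diagE eqxx mulr1n.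
have sy y : eta y = \sum_x sqnorm (c x y).
  apply: (@RtoC_inj R); rewrite -adj_mulmx_diag e2.
  by rewrite real_diagE eqxx mulr1n.
rewrite /shannon; congr (- _).
transitivity (\sum_x \sum_y sqnorm (c x y) * ln (xi x)).
  by apply: eq_bigr => x _; rewrite -mulr_suml -sx.
rewrite exchange_big; apply: eq_bigr => y _ /=.
rewrite [X in X * _]sy mulr_suml.
apply: eq_bigr => x _.
have [->|c0] := eqVneq (sqnorm (c x y)) 0; first by rewrite !mul0r.
by congr (_ * ln _); exact: (mulIf c0 (exy x y)).
Qed.

Lemma vN_entropyE n (A : 'M[C]_n) : vN_entropy A = shannon (eigval A).
Proof. by []. Qed.

(** [K K^*] and [K^* K] have the same nonzero spectrum, as do the two marginals of a pure state.
    This is what replaces a channel output by the state of its environment. *)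
Lemma vN_swap m n (K : 'M[C]_(m, n)) :
  vN_entropy (K *m adjmx K) = vN_entropy (adjmx K *m K).
Proof.
have [h1 _] := psd_eigdec (psd_mul_adj K).
have [h2 _] := psd_eigdec (psd_mul_adj (adjmx K)).
rewrite adjmxK in h2; exact: eigdec_swap h1 h2.
Qed.

(** The entropy does not depend on the diagonalisation: with [K = U^* sqrt(l)] one has [K K^* = A]
    and [K^* K = diag(l)], and the swap compares the two. *)
Lemma vN_eigdec n (A U : 'M[C]_n) l :
  eigdec A U l -> (forall i, 0 <= l i) -> vN_entropy A = shannon l.
Proof.
move=> hA l0; have [hU eA] := hA.
have [h1 _] := psd_eigdec (eigdec_psd hA l0).
pose K := adjmx U *m real_diag (fun i => sqrtr (l i)).
have eK : A = K *m adjmx K.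
  rewrite /K adjmx_mul adj_real_diag adjmxK mulmxA -[X in X *m _]mulmxA.
  by rewrite real_diag_sqr.
have eK' : adjmx K *m K = real_diag l.
  rewrite /K adjmx_mul adj_real_diag adjmxK mulmxA -[X in X *m _]mulmxA.
  by rewrite hU mulmx1 real_diag_sqr.
rewrite [in LHS]eK vN_entropyE; rewrite eK in h1.
apply: (eigdec_swap h1 (V := 1%:M)).
by rewrite eK'; split; rewrite adjmx1 !mul1mx ?mulmx1.
Qed.

Lemma vN_unitary_conj n (A V : 'M[C]_n) : psd A -> V *m adjmx V = 1%:M ->
  vN_entropy (V *m A *m adjmx V) = vN_entropy A.
Proof.
move=> /psd_eigdec[[hU hA] l0] hV; rewrite [RHS]vN_entropyE.
apply: (vN_eigdec (U := spectralmx A *m adjmx V)) => //; split.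
  by rewrite adjmx_mul adjmxK mulmxA -[X in X *m _]mulmxA (mulmx1C hV) mulmx1.
by rewrite {1}hA adjmx_mul adjmxK !mulmxA.
Qed.

Lemma density_eigval n (A : 'M[C]_n) : density A ->
  (forall i, 0 <= eigval A i) /\ \sum_i eigval A i = 1.
Proof.
case=> /psd_eigdec[hA l0] tr1; split=> //.
by apply: (@RtoC_inj R); rewrite -(eigdec_trace hA) tr1.
Qed.

Lemma shannon_ge0 (I : finType) (l : I -> R) :
  (forall i, 0 <= l i) -> \sum_i l i = 1 -> 0 <= shannon l.
Proof.
move=> l0 sl; rewrite /shannon oppr_ge0.
apply: sumr_le0 => i _; apply: mulr_ge0_le0 => //; apply: ln_le0.
by rewrite -sl (bigD1 i) //= lerDl sumr_ge0.
Qed.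

Lemma vN_entropy_ge0 n (A : 'M[C]_n) : density A -> 0 <= vN_entropy A.
Proof. by move=> /density_eigval[? ?]; exact: shannon_ge0. Qed.

End Entropy.

(** * Data processing for isometric mixtures *)

Section Compression.
Variable R : realType.
Local Notation C := (R[i]).

(* For [Y], [S] diagonalised by [f_y], [e_l] with eigenvalues [eta], [s], the
   maximum of this form over [W] is
   [\sum_(y, l) eta_y^2 |<f_y, e_l>|^2 / (s_l + t eta_y)], the resolvent part of
   the relative entropy of [Y] and [S]; it is jointly affine in [(Y, S)]. *)
Definition resolvent_form (t : R) n (W Y S : 'M[C]_n) : C :=
  \tr (adjmx W *m Y) + \tr (Y *m W) - \tr (W *m S *m adjmx W)
  - RtoC t * \tr (adjmx W *m Y *m W).

Lemma resolvent_form_sum t n (W : 'M[C]_n) (I : finType) (c : I -> R)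
    (Y S : I -> 'M[C]_n) :
  resolvent_form t W (\sum_i RtoC (c i) *: Y i) (\sum_i RtoC (c i) *: S i) =
  \sum_i RtoC (c i) * resolvent_form t W (Y i) (S i).
Proof.
rewrite /resolvent_form !(mulmx_sumr, mulmx_suml) !(raddf_sum (@mxtrace C n)) /=.
rewrite [RtoC t * _]mulr_sumr -big_split /= -!sumrB; apply: eq_bigr => i _ /=.
rewrite -!(scalemxAl, scalemxAr) !mxtraceZ; ring.
Qed.

Lemma isometry_compl n k (J : 'M[C]_(n, k)) (P := 1%:M - J *m adjmx J) :
  adjmx J *m J = 1%:M -> P = P *m adjmx P.
Proof.
move=> hJ; rewrite /P adjmxB adjmx1 adjmx_mul adjmxK.
have e : J *m adjmx J *m (J *m adjmx J) = J *m adjmx J.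
  by rewrite mulmxA -[J *m _ *m J]mulmxA hJ mulmx1.
by rewrite mulmxBl mul1mx mulmxBr mulmx1 e subrr subr0.
Qed.

(** The linear terms agree by cyclicity of the trace. The quadratic terms enter with a minus sign,
    and compressing each of them by the isometry discards a nonnegative trace that involves the
    complementary projection [P]. *)
Lemma resolvent_form_compress t n k (J : 'M[C]_(n, k)) (D : 'M[C]_k) W :
  0 <= t -> psd D -> adjmx J *m J = 1%:M ->
  resolvent_form t W (J *m D *m adjmx J) (J *m adjmx J) <=
  resolvent_form t (adjmx J *m W *m J) D 1%:M.
Proof.
move=> t0 hD hJ; pose P := 1%:M - J *m adjmx J.
have hP : P = P *m adjmx P by exact: isometry_compl.
rewrite /resolvent_form !adjmx_mul !adjmxK mulmx1.
have e1 : \tr (adjmx W *m (J *m D *m adjmx J)) =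
    \tr (adjmx J *m (adjmx W *m J) *m D).
  by rewrite !mulmxA mxtrace_mulC !mulmxA.
have e2 : \tr (J *m D *m adjmx J *m W) = \tr (D *m (adjmx J *m W *m J)).
  by rewrite -!mulmxA mxtrace_mulC !mulmxA.
rewrite e1 e2; apply: lerB; [apply: lerB|] => //.
  rewrite -subr_ge0.
  have -> : \tr (W *m (J *m adjmx J) *m adjmx W) -
      \tr (adjmx J *m W *m J *m (adjmx J *m (adjmx W *m J))) =
      \tr (adjmx (W *m J) *m P *m (W *m J)).
    rewrite /P mulmxBr mulmx1 mulmxBl linearB /= adjmx_mul; congr (_ - _).
      by rewrite [RHS]mxtrace_mulC !mulmxA.
    transitivity (\tr ((adjmx J *m adjmx W *m J) *m (adjmx J *m W *m J))).
      by rewrite [RHS]mxtrace_mulC !mulmxA.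
    by rewrite !mulmxA.
  apply: psd_trace_ge0; rewrite hP.
  have := psd_mul_adj (adjmx (W *m J) *m P).
  by rewrite [adjmx (_ *m P)]adjmx_mul adjmxK !mulmxA.
rewrite ler_wpM2l ?RtoC_ge0 // -subr_ge0.
have -> : \tr (adjmx W *m (J *m D *m adjmx J) *m W) -
    \tr (adjmx J *m (adjmx W *m J) *m D *m (adjmx J *m W *m J)) =
    \tr (adjmx (adjmx J *m W *m P) *m D *m (adjmx J *m W *m P)).
  transitivity (\tr ((adjmx W *m (J *m D *m adjmx J) *m W) *m (P *m adjmx P))).
    rewrite -hP /P mulmxBr mulmx1 linearB /=; congr (_ - _).
    transitivity (\tr (adjmx J *m (adjmx W *m (J *m D *m adjmx J) *m W *m J))).
      by rewrite !mulmxA.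
    by rewrite [LHS]mxtrace_mulC !mulmxA.
  rewrite !adjmx_mul adjmxK; clearbody P.
  transitivity (\tr ((adjmx W *m (J *m D *m adjmx J) *m W *m P) *m adjmx P)).
    by rewrite !mulmxA.
  by rewrite [LHS]mxtrace_mulC !mulmxA.
apply: psd_trace_ge0.
have := psd_conj (adjmx (adjmx J *m W *m P)) hD.
by rewrite adjmxK.
Qed.

Lemma resolvent_form_conj t n (U W D : 'M[C]_n) : U *m adjmx U = 1%:M ->
  resolvent_form t (adjmx U *m W *m U) (adjmx U *m D *m U) 1%:M =
  resolvent_form t W D 1%:M.
Proof.
move=> hU; rewrite /resolvent_form.
have cjM X Y : adjmx U *m X *m U *m (adjmx U *m Y *m U) =
    adjmx U *m (X *m Y) *m U.
  by rewrite !mulmxA -[adjmx U *m X *m U *m _]mulmxA hU mulmx1.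
have cjT X : \tr (adjmx U *m X *m U) = \tr X.
  by rewrite mxtrace_mulC mulmxA hU mul1mx.
have -> : adjmx (adjmx U *m W *m U) = adjmx U *m adjmx W *m U.
  by rewrite adjmx_mul [adjmx (adjmx U *m W)]adjmx_mul adjmxK mulmxA.
move: (adjmx U) cjM cjT => V cjM cjT.
rewrite [V *m W *m U *m 1%:M]mulmx1 [W *m 1%:M]mulmx1.
by rewrite 3![V *m _ *m U *m (V *m _ *m U)]cjM cjM 4!cjT.
Qed.

(** Only the diagonal of [w] meets the linear terms, so off-diagonal entries can only lower the
    value. On the diagonal, completing the square bounds [2 l Re(w) - (1 + t l) |w|^2] by
    [l^2 / (1 + t l)]. *)
Lemma resolvent_form_diag_le t n (w : 'M[C]_n) l :
  0 < t -> (forall i, 0 <= l i) ->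
  resolvent_form t w (real_diag l) 1%:M <=
  RtoC (\sum_i l i ^+ 2 / (1 + t * l i)).
Proof.
move=> t0 l0; rewrite /resolvent_form [w *m 1%:M]mulmx1.
rewrite -[adjmx w *m _ *m w]mulmxA [X in RtoC t * X]mxtrace_mulC.
rewrite -[real_diag l *m w *m _]mulmxA.
rewrite /mxtrace mulr_sumr RtoC_sum -big_split /= -!sumrB.
apply: ler_sum => i _ /=.
have tl : 0 < 1 + t * l i by rewrite ltr_wpDr // mulr_ge0 // ltW.
set N := \sum_j sqnorm (w i j).
have N0 : sqnorm (w i i) <= N.
  by rewrite /N (bigD1 i) //= lerDl sumr_ge0 // => j _; exact: sqnorm_ge0.
rewrite mulmx_real_diagE !real_diag_mulmxE mulmx_adj_diag -/N adjmxE.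
have hb : RtoC (1 + t * l i) != 0 by rewrite -RtoC0 (inj_eq (@RtoC_inj R)) gt_eqF.
apply: (@le_trans _ _ ((w i i)^* * RtoC (l i) + RtoC (l i) * w i i
    - RtoC (1 + t * l i) * RtoC (sqnorm (w i i)))).
  have -> : forall a b : C, a + b - RtoC N - RtoC t * (RtoC (l i) * RtoC N) =
      a + b - RtoC (1 + t * l i) * RtoC N.
    by move=> a b; rewrite RtoCD RtoC1 RtoCM; ring.
  by rewrite lerD2l lerN2 -!RtoCM RtoC_le ler_wpM2l // ltW.
rewrite -subr_ge0.
have -> : RtoC (l i ^+ 2 / (1 + t * l i)) - ((w i i)^* * RtoC (l i) +
    RtoC (l i) * w i i - RtoC (1 + t * l i) * RtoC (sqnorm (w i i))) =
    RtoC ((1 + t * l i)^-1 * sqnorm (RtoC (1 + t * l i) * w i i - RtoC (l i))).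
  rewrite expr2 !RtoCM !RtoCV !sqnormE rmorphB rmorphM /= !conj_RtoC.
  move: hb; set b := RtoC (1 + _).
  move: b (RtoC (l i)) (w i i) ((w i i)^*) => b L z z' hb.
  by field.
by rewrite RtoC_ge0 mulr_ge0 ?sqnorm_ge0 // invr_ge0 ltW.
Qed.


Lemma resolvent_form_le t n (D U W : 'M[C]_n) l :
  0 < t -> eigdec D U l -> (forall i, 0 <= l i) ->
  resolvent_form t W D 1%:M <= RtoC (\sum_i l i ^+ 2 / (1 + t * l i)).
Proof.
move=> t0 [hU ->] l0; have hU' := mulmx1C hU.
have -> : W = adjmx U *m (U *m W *m adjmx U) *m U.
  by rewrite !mulmxA hU' mul1mx -mulmxA hU' mulmx1.
rewrite resolvent_form_conj //; exact: resolvent_form_diag_le.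
Qed.

End Compression.

(** * Monotonicity of the relative entropy and concavity of the entropy *)

Section CoreInequality.
Variable R : realType.
Local Notation C := (R[i]).

Lemma resolvent_form_attained t n (Y V : 'M[C]_n) eta s :
  0 < t -> eigdec Y V eta -> (forall y, 0 <= eta y) -> (forall l, 0 <= s l) ->
  exists W, resolvent_form t W Y (real_diag s) =
    RtoC (\sum_y \sum_l eta y ^+ 2 * sqnorm (V y l) / (s l + t * eta y)).
Proof.
move=> t0 [hV ->] e0 s0.
pose b y l := s l + t * eta y.
(* The critical point of the form: in the eigenbases of the two operators the quadratic part has
   coefficient [b y l] and the linear part [eta y * V y l]. *)
pose w : 'M[C]_n := \matrix_(y, l) (RtoC (eta y / b y l) * V y l).
have hVX (X : 'M_n) : V *m (adjmx V *m X) = X by rewrite mulmxA hV mul1mx.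
exists (adjmx V *m w); rewrite /resolvent_form.
have -> : adjmx (adjmx V *m w) = adjmx w *m V by rewrite adjmx_mul adjmxK.
have -> : \tr (adjmx w *m V *m (adjmx V *m real_diag eta *m V)) =
    \tr (real_diag eta *m (V *m adjmx w)).
  by rewrite -!mulmxA hVX mxtrace_mulC -mulmxA.
have -> : \tr (adjmx V *m real_diag eta *m V *m (adjmx V *m w)) =
    \tr (real_diag eta *m (w *m adjmx V)).
  by rewrite -!mulmxA hVX mxtrace_mulC -mulmxA.
have -> : \tr (adjmx V *m w *m real_diag s *m (adjmx w *m V)) =
    \tr (w *m real_diag s *m adjmx w).
  by rewrite mulmxA mxtrace_mulC !mulmxA hV mul1mx.
have -> : \tr (adjmx w *m V *m (adjmx V *m real_diag eta *m V) *m
    (adjmx V *m w)) = \tr (real_diag eta *m (w *m adjmx w)).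
  by rewrite -!mulmxA !hVX mxtrace_mulC -mulmxA.
rewrite /mxtrace mulr_sumr -big_split /= -!sumrB RtoC_sum.
apply: eq_bigr => y _; rewrite !real_diag_mulmxE !mxE !mulr_sumr.
rewrite -big_split /= -!sumrB RtoC_sum; apply: eq_bigr => l _.
rewrite mulmx_real_diagE !adjmxE !mxE rmorphM /= conj_RtoC.
have -> : eta y ^+ 2 * sqnorm (V y l) / (s l + t * eta y) =
  2%:R * (eta y * (eta y / b y l)) * sqnorm (V y l) -
  (eta y / b y l) ^+ 2 * b y l * sqnorm (V y l).
  have [eb|nb] := eqVneq (b y l) 0; last by rewrite /b in nb *; field.
  have ey : eta y = 0.
    apply/eqP; rewrite eq_le e0 andbT leNgt; apply/negP => ey.
    by move: eb => /eqP; rewrite gt_eqF // /b ltr_wpDl // mulr_gt0.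
  by rewrite ey !(mul0r, expr0n, mulr0, subrr) /=.
rewrite /b RtoCB !expr2 !RtoCM sqnormE.
move: (RtoC (s l + t * eta y)^-1) => B.
rewrite !RtoCD RtoCM RtoC1.
move: (V y l) (RtoC (eta y)) (RtoC t) (RtoC (s l)) => z e t' s'.
by move: z^* => z'; ring.
Qed.

Lemma eigdec_diag_entry n (Y V : 'M[C]_n) eta l : eigdec Y V eta ->
  Y l l = RtoC (\sum_y eta y * sqnorm (V y l)).
Proof.
case=> _ ->; rewrite -mulmxA mxE RtoC_sum; apply: eq_bigr => y _.
rewrite adjmxE real_diag_mulmxE RtoCM sqnormE; ring.
Qed.

Lemma unitary_row_sum n (V : 'M[C]_n) y : V *m adjmx V = 1%:M ->
  \sum_l sqnorm (V y l) = 1.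
Proof.
move=> hV; apply: (@RtoC_inj R); rewrite -mulmx_adj_diag hV.
by rewrite mxE eqxx.
Qed.

Section Core.
Variables (I : finType) (n k : nat) (c : I -> R) (J : I -> 'M[C]_(n, k)).
Variables (D : I -> 'M[C]_k) (s : 'I_n -> R).
Hypothesis c0 : forall i, 0 <= c i.
Hypothesis hJ : forall i, adjmx (J i) *m J i = 1%:M.
Hypothesis hD : forall i, psd (D i).
Hypothesis hs : \sum_i RtoC (c i) *: (J i *m adjmx (J i)) = real_diag s.

Let Y := \sum_i RtoC (c i) *: (J i *m D i *m adjmx (J i)).

Lemma isometry_mix_diag l : RtoC (s l) =
  RtoC (\sum_i c i * \sum_j sqnorm (J i l j)).
Proof.
have := congr1 (fun M : 'M_n => M l l) hs.
rewrite /= real_diagE eqxx mulr1n => <-.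
rewrite summxE RtoC_sum; apply: eq_bigr => i _.
by rewrite mxE mulmx_adj_diag RtoCM.
Qed.

Lemma isometry_mix_ge0 l : 0 <= s l.
Proof.
rewrite -RtoC_ge0 isometry_mix_diag RtoC_ge0 sumr_ge0 // => i _.
by rewrite mulr_ge0 // sumr_ge0 // => j _; exact: sqnorm_ge0.
Qed.

(** [s l = 0] forces row [l] of [J i] to vanish whenever [c i != 0]. Thus the support of [Y] lies in
    that of the reference operator, and [ln (s l)] carries no weight where [s l = 0]. *)
Lemma isometry_mix_eq0 l : s l = 0 -> Y l l = 0.
Proof.
move=> sl; rewrite /Y summxE big1 // => i _; rewrite mxE.
have /eqP := RtoC_inj (isometry_mix_diag l).
rewrite sl eq_sym psumr_eq0; last first.
  by move=> j _; rewrite mulr_ge0 // sumr_ge0 // => m _; exact: sqnorm_ge0.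
move=> /allP /(_ i (mem_index_enum i)); rewrite mulf_eq0 => /orP[/eqP ->|].
  by rewrite mul0r.
rewrite psumr_eq0; last by move=> j _; exact: sqnorm_ge0.
move=> /allP hJ0; rewrite -mulmxA mxE big1 ?mulr0 // => j _.
have := hJ0 j (mem_index_enum j); rewrite sqnorm_eq0 => /eqP ->.
by rewrite mul0r.
Qed.

(* Data processing for the relative entropy of [\sum_i c_i |i><i| (x) D_i] and
   [\sum_i c_i |i><i| (x) 1] under the channel [|i><i| (x) X |-> J_i X J_i^*]. *)
Lemma vN_isometry_mix :
  \sum_i c i * vN_entropy (D i) <=
  vN_entropy Y + \sum_l complex.Re (Y l l) * ln (s l).
Proof.
have hY : psd Y.
  by apply: psd_sum => i; apply: psdZ; [rewrite RtoC_ge0|exact: psd_conj].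
have [dY eta0] := psd_eigdec hY; have [hV _] := dY.
move: (spectralmx Y) (eigval Y) (vN_entropyE Y) dY eta0 hV => V eta -> dY eta0 hV.
pose lam i := eigval (D i).
have dD i : eigdec (D i) (spectralmx (D i)) (lam i).
  by have [] := psd_eigdec (hD i).
have lam0 i a : 0 <= lam i a by have [_ h] := psd_eigdec (hD i); exact: h.
(* Joint weights of the eigenvectors of [Y] and of the diagonal operator [s] (the Nussbaum-Szkola
   distribution), with [x] the ratio of eigenvalues: the sum of [w ln x] is minus a relative
   entropy. The pair [w'], [y] does the same for the [D i] against the identity. *)
pose w (p : 'I_n * 'I_n) := eta p.1 * sqnorm (V p.1 p.2).
pose x (p : 'I_n * 'I_n) := s p.2 / eta p.1.
pose w' (p : I * 'I_k) := c p.1 * lam p.1 p.2.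
pose y (p : I * 'I_k) := (lam p.1 p.2)^-1.
have s0 := isometry_mix_ge0.
have reY l : complex.Re (Y l l) = \sum_y eta y * sqnorm (V y l).
  by rewrite (eigdec_diag_entry l dY).
have w0 z l : s l = 0 -> eta z * sqnorm (V z l) = 0.
  move=> sl; have := isometry_mix_eq0 sl.
  rewrite (eigdec_diag_entry l dY) => /(@RtoC_inj R)/eqP.
  rewrite psumr_eq0; last by move=> j _; rewrite mulr_ge0 // sqnorm_ge0.
  by move=> /allP /(_ z (mem_index_enum z)) /eqP.
have := @ln_majorization R _ _ w x w' y.
have -> : \sum_p w' p * ln (y p) = \sum_i c i * vN_entropy (D i).
  rewrite -(pair_bigA _ (fun i a => w' (i, a) * ln (y (i, a)))) /=.
  apply: eq_bigr => i _; rewrite vN_entropyE /shannon mulrN mulr_sumr -sumrN.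
  apply: eq_bigr => a _; rewrite /w' /y /= -mulrA.
  rewrite -[eigval (D i) a]/(lam i a).
  have [->|la] := eqVneq (lam i a) 0; first by rewrite !mul0r !mulr0 oppr0.
  have la0 : 0 < lam i a by rewrite lt_def la lam0.
  by rewrite lnV ?posrE // !mulrN.
have -> : \sum_p w p * ln (x p) =
    shannon eta + \sum_l complex.Re (Y l l) * ln (s l).
  rewrite -(pair_bigA _ (fun z l => w (z, l) * ln (x (z, l)))) /=.
  have -> : \sum_l complex.Re (Y l l) * ln (s l) =
      \sum_z \sum_l w (z, l) * ln (s l).
    rewrite exchange_big; apply: eq_bigr => l _ /=.
    by rewrite reY mulr_suml.
  have -> : shannon eta = \sum_z \sum_l - (w (z, l) * ln (eta z)).
    rewrite /shannon -sumrN; apply: eq_bigr => z _.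
    rewrite sumrN -mulr_suml /w /= -mulr_sumr unitary_row_sum // mulr1.
    by [].
  rewrite -big_split; apply: eq_bigr => z _; rewrite -big_split.
  apply: eq_bigr => l _ /=.
  have [->|wn] := eqVneq (w (z, l)) 0; first by rewrite !mul0r oppr0 addr0.
  have ez : 0 < eta z.
    rewrite lt_def eta0 andbT; apply: contra wn => /eqP ez.
    by rewrite /w /= ez mul0r.
  have sl : 0 < s l.
    rewrite lt_def s0 andbT; apply: contra wn => /eqP sl.
    by rewrite /w /= w0.
  by rewrite /x /= ln_div ?posrE // mulrBr addrC.
apply.
- case=> z l /=; rewrite /w /x /= => wn.
  have ez : 0 < eta z.
    rewrite lt_def eta0 andbT; apply: contra wn => /eqP ->.
    by rewrite mul0r.
  have sl : 0 < s l.
    rewrite lt_def s0 andbT; apply: contra wn => /eqP sl.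
    by rewrite w0.
  exact: divr_gt0.
- case=> i a; rewrite /w' /y /= invr_gt0 lt_def lam0 andbT.
  by rewrite mulf_eq0 negb_or => /andP[].
- rewrite -(pair_bigA _ (fun z l => w (z, l))) /=.
  rewrite -(pair_bigA _ (fun i a => w' (i, a))) /= /w /w' /=.
  under eq_bigr do rewrite -mulr_sumr unitary_row_sum // mulr1.
  apply: (@RtoC_inj R); rewrite -(eigdec_trace dY) /Y raddf_sum RtoC_sum /=.
  apply: eq_bigr => i _; rewrite mxtraceZ mxtrace_mulC mulmxA hJ mul1mx.
  by rewrite -mulr_sumr RtoCM -(eigdec_trace (dD i)).
- move=> t t0; rewrite -(pair_bigA _ (fun z l => w (z, l) / (x (z, l) + t))) /=.
  rewrite -(pair_bigA _ (fun i a => w' (i, a) / (y (i, a) + t))) /=.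
  (* [W] is optimal for the mixture. Affinity splits the form over [i], compression moves each term
     to [D i] and the identity, and there the maximum bounds it. *)
  have [W hW] := resolvent_form_attained t0 dY eta0 s0.
  rewrite -RtoC_le; apply: (@le_trans _ _ (resolvent_form t W Y (real_diag s))).
    rewrite hW RtoC_le; apply: ler_sum => z _; apply: ler_sum => l _.
    rewrite /w /x /=; have [->|ez] := eqVneq (eta z) 0.
      by rewrite !mul0r expr0n /= !mul0r.
    have ez0 : 0 < eta z by rewrite lt_def ez eta0.
    rewrite le_eqVlt; apply/orP; left; apply/eqP; field.
    by rewrite ez /= gt_eqF // ltr_wpDl // mulr_gt0.
  rewrite -hs resolvent_form_sum RtoC_sum; apply: ler_sum => i _.
  apply: (@le_trans _ _ (RtoC (c i) *
      RtoC (\sum_a lam i a ^+ 2 / (1 + t * lam i a)))).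
    rewrite ler_wpM2l ?RtoC_ge0 //.
    apply: le_trans (resolvent_form_compress _ _ _ _) _ => //; first exact: ltW.
    exact: (resolvent_form_le _ t0 (dD i) (lam0 i)).
  rewrite -RtoCM RtoC_le mulr_sumr; apply: ler_sum => a _.
  rewrite /w' /y /=; have [->|la] := eqVneq (lam i a) 0.
    by rewrite expr0n /= !(mul0r, mulr0).
  have la0 : 0 < lam i a by rewrite lt_def la lam0.
  rewrite le_eqVlt; apply/orP; left; apply/eqP; field.
  by rewrite la /= gt_eqF // ltr_wpDr // mulr_ge0 // ltW.
Qed.

End Core.

(** The case where every isometry is the identity: as the weights sum to one, the reference operator
    is the identity, whose logarithm vanishes. *)
Lemma vN_concave (I : finType) n (c : I -> R) (D : I -> 'M[C]_n) :
  (forall i, 0 <= c i) -> \sum_i c i = 1 -> (forall i, psd (D i)) ->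
  \sum_i c i * vN_entropy (D i) <= vN_entropy (\sum_i RtoC (c i) *: D i).
Proof.
move=> c0 c1 hD.
have h1 (i : I) : adjmx (1%:M : 'M[C]_n) *m 1%:M = 1%:M.
  by rewrite adjmx1 mulmx1.
have h2 : \sum_i RtoC (c i) *: (1%:M *m adjmx (1%:M : 'M[C]_n)) =
    real_diag (fun=> 1).
  rewrite -scaler_suml adjmx1 mulmx1 -RtoC_sum c1 scale1r.
  by apply/matrixP => i j; rewrite real_diagE mxE.
have := vN_isometry_mix c0 h1 hD h2.
rewrite ln1; under [X in _ + X]eq_bigr do rewrite mulr0.
rewrite [X in _ + X]big1 // addr0.
by under [X in vN_entropy X]eq_bigr do rewrite adjmx1 mulmx1 mul1mx.
Qed.

End CoreInequality.

(** * Block matrices *)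

Section Blocks.
Variable R : realType.
Local Notation C := (R[i]).

(** Operators on a tensor product are handled as matrices of blocks indexed by the first factor;
    [blk] and [rblk] extract the blocks that [blk_mx] and [blk_col] assemble. *)
Definition blk_mx m n p q (F : 'I_m -> 'I_n -> 'M[C]_(p, q)) :
    'M[C]_(m * p, n * q) :=
  \matrix_(x, y) F (mxtens_unindex x).1 (mxtens_unindex y).1
                   (mxtens_unindex x).2 (mxtens_unindex y).2.

Definition blk_col m p q (F : 'I_m -> 'M[C]_(p, q)) : 'M[C]_(m * p, q) :=
  \matrix_(x, y) F (mxtens_unindex x).1 (mxtens_unindex x).2 y.

Definition blk m n p q (X : 'M[C]_(m * p, n * q)) i j : 'M[C]_(p, q) :=
  \matrix_(a, b) X (mxtens_index (i, a)) (mxtens_index (j, b)).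

Definition rblk m p q (X : 'M[C]_(m * p, q)) i : 'M[C]_(p, q) :=
  \matrix_(a, b) X (mxtens_index (i, a)) b.

Lemma sum_mxtens (V : nmodType) m p (f : 'I_(m * p) -> V) :
  \sum_x f x = \sum_i \sum_a f (mxtens_index (i, a)).
Proof.
rewrite pair_bigA /= (reindex (@mxtens_index m p)) /=.
  by apply: eq_bigr => -[i a].
exists (@mxtens_unindex m p) => x _; [exact: mxtens_indexK|exact: mxtens_unindexK].
Qed.

Lemma blk_mxK m n p q (F : 'I_m -> 'I_n -> 'M[C]_(p, q)) i j :
  blk (blk_mx F) i j = F i j.
Proof. by apply/matrixP => a b; rewrite !mxE !mxtens_indexK. Qed.

Lemma blk_colK m p q (F : 'I_m -> 'M[C]_(p, q)) i : rblk (blk_col F) i = F i.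
Proof. by apply/matrixP => a b; rewrite !mxE !mxtens_indexK. Qed.

Lemma blkP m n p q (X Y : 'M[C]_(m * p, n * q)) :
  (forall i j, blk X i j = blk Y i j) -> X = Y.
Proof.
move=> h; apply/matrixP => x y.
case: (mxtens_indexP x) => i a; case: (mxtens_indexP y) => j b.
by have /matrixP /(_ a b) := h i j; rewrite !mxE.
Qed.

Lemma blk_mul m n l p q r (X : 'M[C]_(m * p, n * q)) (Y : 'M[C]_(n * q, l * r)) i j :
  blk (X *m Y) i j = \sum_h blk X i h *m blk Y h j.
Proof.
apply/matrixP => a b; rewrite summxE !mxE sum_mxtens; apply: eq_bigr => h _.
by rewrite mxE; apply: eq_bigr => e _; rewrite !mxE.
Qed.

Lemma blk_adj m n p q (X : 'M[C]_(m * p, n * q)) i j :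
  blk (adjmx X) i j = adjmx (blk X j i).
Proof. by apply/matrixP => a b; rewrite mxE !adjmxE mxE. Qed.

Lemma blk_mul_adj m n p q l (X : 'M[C]_(m * p, l)) (Y : 'M[C]_(n * q, l)) i j :
  blk (X *m adjmx Y) i j = rblk X i *m adjmx (rblk Y j).
Proof.
apply/matrixP => a b; rewrite !mxE; apply: eq_bigr => e _.
by rewrite !adjmxE !mxE.
Qed.

Lemma adj_mul_rblk m p q l (X : 'M[C]_(m * p, q)) (Y : 'M[C]_(m * p, l)) :
  adjmx X *m Y = \sum_i adjmx (rblk X i) *m rblk Y i.
Proof.
apply/matrixP => a b; rewrite summxE !mxE sum_mxtens; apply: eq_bigr => h _.
by rewrite mxE; apply: eq_bigr => e _; rewrite !adjmxE !mxE.
Qed.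

Lemma rblk_mul m p q l (X : 'M[C]_(m * p, q)) (Y : 'M[C]_(q, l)) i :
  rblk (X *m Y) i = rblk X i *m Y.
Proof.
by apply/matrixP => a b; rewrite !mxE; apply: eq_bigr => e _; rewrite !mxE.
Qed.

Lemma blkZ m n p q z (X : 'M[C]_(m * p, n * q)) i j :
  blk (z *: X) i j = z *: blk X i j.
Proof. by apply/matrixP => a b; rewrite !mxE. Qed.

Lemma blk_sum m n p q (I : finType) (X : I -> 'M[C]_(m * p, n * q)) i j :
  blk (\sum_e X e) i j = \sum_e blk (X e) i j.
Proof.
apply/matrixP => a b; rewrite mxE !summxE; apply: eq_bigr => e _.
by rewrite mxE.
Qed.

Lemma blk_diag m p (f : 'I_m -> R) i j :
  blk (real_diag (fun x : 'I_(m * p) => f (mxtens_unindex x).1)) i j =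
  (RtoC (f i) *+ (i == j))%:M.
Proof.
apply/matrixP => a b; rewrite mxE real_diagE !mxE mxtens_indexK /=.
rewrite (inj_eq (can_inj (@mxtens_indexK m p))) xpair_eqE.
by case: (i == j); case: (a == b); rewrite //= !mulr0n.
Qed.

Lemma mxtrace_blk m p (X : 'M[C]_(m * p)) : \tr X = \sum_i \tr (blk X i i).
Proof.
rewrite /mxtrace sum_mxtens; apply: eq_bigr => i _.
by apply: eq_bigr => a _; rewrite mxE.
Qed.

Lemma ptrace2E m p (X : 'M[C]_(m * p)) i j : ptrace2 X i j = \tr (blk X i j).
Proof. by rewrite mxE; apply: eq_bigr => a _; rewrite mxE. Qed.

Lemma ptrace1E m p (X : 'M[C]_(m * p)) : ptrace1 X = \sum_i blk X i i.
Proof.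
apply/matrixP => a b; rewrite mxE summxE; apply: eq_bigr => i _.
by rewrite mxE.
Qed.

Lemma adjmx_sum (I : finType) m n (F : I -> 'M[C]_(m, n)) :
  adjmx (\sum_i F i) = \sum_i adjmx (F i).
Proof.
apply/matrixP => a b; rewrite adjmxE !summxE rmorph_sum.
by apply: eq_bigr => i _; rewrite adjmxE.
Qed.

(* [<b| X |b>], with [b] acting on the first tensor factor. *)
Definition contract m p (b : 'I_m -> C) (X : 'M[C]_(m * p)) : 'M[C]_p :=
  \sum_x \sum_y (b x * (b y)^* ) *: blk X x y.

Lemma contract_mul_adj m p q (b : 'I_m -> C) (A : 'M[C]_(m * p, q)) :
  contract b (A *m adjmx A) =
  (\sum_x b x *: rblk A x) *m adjmx (\sum_x b x *: rblk A x).
Proof.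
rewrite adjmx_sum mulmx_suml; apply: eq_bigr => x _.
rewrite mulmx_sumr; apply: eq_bigr => y _.
by rewrite blk_mul_adj adjmxZ -scalemxAl -scalemxAr scalerA.
Qed.

Lemma contract_trace m p (b : 'I_m -> C) (X : 'M[C]_(m * p)) :
  \tr (contract b X) = \sum_x \sum_y (b x * (b y)^* ) * ptrace2 X x y.
Proof.
rewrite /contract (raddf_sum (@mxtrace C p)); apply: eq_bigr => x _.
rewrite (raddf_sum (@mxtrace C p)); apply: eq_bigr => y _.
by rewrite /= mxtraceZ ptrace2E.
Qed.

Lemma contract_psd m p (b : 'I_m -> C) (X : 'M[C]_(m * p)) :
  psd X -> psd (contract b X).
Proof. by move=> /psd_sqrt[A ->]; rewrite contract_mul_adj; exact: psd_mul_adj. Qed.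

Lemma vN_scale_swap m n (a : R) (K : 'M[C]_(m, n)) : 0 <= a ->
  vN_entropy (RtoC a *: (adjmx K *m K)) = vN_entropy (RtoC a *: (K *m adjmx K)).
Proof.
move=> a0; have := vN_swap (RtoC (sqrtr a) *: K).
rewrite adjmxZ conj_RtoC -!scalemxAl -!scalemxAr !scalerA -RtoCM.
by rewrite -expr2 sqr_sqrtr // => ->.
Qed.

End Blocks.

(** * Phase damping in one basis *)

Section PhaseDamping.
Variable R : realType.
Local Notation C := (R[i]).

Section OneBasis.
(** [b i] holds the components of the bra [<b_i|] of an orthonormal basis, [u] the phases of a
    diagonal unitary, and the [m i] are vectors with the Gram matrix of the damping, whose uniform
    mixture is diagonal with entries [c]. *)
Variables (d k : nat) (lam : R) (c : 'I_d -> R).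
Variables (b m : 'I_d -> 'I_d -> C) (u : 'I_d -> C).
Hypothesis d0 : (0 < d)%N.
Hypothesis c1 : \sum_h c h = 1.
Hypothesis u1 : forall x, u x * (u x)^* = 1.
Hypothesis b_rows : forall i j, \sum_x b i x * (b j x)^* = (i == j)%:R.
Hypothesis b_cols : forall x y, \sum_i (b i x)^* * b i y = (x == y)%:R.
Hypothesis m_norm : forall i h, m i h * (m i h)^* = RtoC (c h).
Hypothesis m_gram : forall i j,
  \sum_h (m i h)^* * m j h = RtoC lam + RtoC (1 - lam) *+ (i == j).
Hypothesis m_mix : forall h l,
  \sum_i RtoC d%:R^-1 * (m i h * (m i l)^* ) = RtoC (c h) *+ (h == l).

(** The sum over [i] is the pinching [\sum_i P_i X P_i] on the first factor, with [P_i] the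
    projection onto [b_i]; the outer factor is conjugation by the diagonal unitary. *)
Definition dephase (X : 'M[C]_(d * k)) : 'M[C]_(d * k) :=
  blk_mx (fun x y => (u x * (u y)^* ) *: (RtoC lam *: blk X x y +
    RtoC (1 - lam) *: \sum_i ((b i x)^* * b i y) *: contract (b i) X)).

Variables (q : nat) (A : 'M[C]_(d * k, q)).
Let X := A *m adjmx A.
Let Ab i := \sum_x b i x *: rblk A x.
(** A factor of the output: [K K^*] is the damped state and [K^* K] that of the environment, where
    [h] labels the coordinates of the [m_i]. *)
Let K : 'M[C]_(d * k, d * q) :=
  blk_mx (fun x h => \sum_i (u x * (b i x)^* * (m i h)^* ) *: Ab i).
(** [J i] sends [v] to [m_i (x) v]. The factor [d] in [D i] makes up for the uniform weights
    [1 / d]. *)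
Let J i : 'M[C]_(d * q, q) := blk_col (fun h => (m i h)%:M).
Let D i : 'M[C]_q := RtoC d%:R *: (adjmx (Ab i) *m Ab i).

Let dR0 : (d%:R : R) != 0.
Proof. by rewrite pnatr_eq0 -lt0n. Qed.

Let contractE i : contract (b i) X = Ab i *m adjmx (Ab i).
Proof. exact: contract_mul_adj. Qed.

Let Ab_inv x : \sum_i (b i x)^* *: Ab i = rblk A x.
Proof.
under eq_bigr do rewrite scaler_sumr.
rewrite exchange_big /= (bigD1 x) //= [X in _ + X]big1 ?addr0 => [|y yx].
  under eq_bigr do rewrite scalerA.
  by rewrite -scaler_suml b_cols eqxx scale1r.
under eq_bigr do rewrite scalerA.
by rewrite -scaler_suml b_cols eq_sym (negPf yx) scale0r.
Qed.

(** Summing over [h] produces the Gram matrix of the [m_i]: its constant part [lam] rebuilds [X] by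
    completeness of the basis, and its diagonal part gives the pinching. *)
Lemma dephaseE : K *m adjmx K = dephase X.
Proof.
clearbody Ab; apply: blkP => x y; rewrite blk_mul blk_mxK.
under eq_bigr do rewrite blk_adj !blk_mxK adjmx_sum mulmx_suml.
transitivity (\sum_i \sum_j (u x * (u y)^* * ((b i x)^* * b j y) *
    (\sum_h (m i h)^* * m j h)) *: (Ab i *m adjmx (Ab j))).
  rewrite exchange_big; apply: eq_bigr => i _ /=.
  under eq_bigr do rewrite mulmx_sumr.
  rewrite exchange_big; apply: eq_bigr => j _ /=.
  rewrite mulr_sumr scaler_suml; apply: eq_bigr => h _.
  rewrite adjmxZ -scalemxAl -scalemxAr scalerA !rmorphM /= !conjCK.
  by congr (_ *: _); ring.
rewrite scalerDr blk_mul_adj -!Ab_inv adjmx_sum.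
transitivity (\sum_i \sum_j ((u x * (u y)^* * ((b i x)^* * b j y) *
    RtoC lam) *: (Ab i *m adjmx (Ab j)) + (u x * (u y)^* * ((b i x)^* * b j y) *
    RtoC (1 - lam) *+ (i == j)) *: (Ab i *m adjmx (Ab j)))).
  apply: eq_bigr => i _; apply: eq_bigr => j _.
  by rewrite m_gram mulrDr scalerDl mulrnAr.
under eq_bigr do rewrite big_split.
rewrite big_split /=; congr (_ + _).
  rewrite mulmx_suml !scaler_sumr; apply: eq_bigr => i _.
  rewrite mulmx_sumr !scaler_sumr; apply: eq_bigr => j _.
  rewrite adjmxZ -scalemxAl -scalemxAr !scalerA conjCK; congr (_ *: _); ring.
rewrite !scaler_sumr; apply: eq_bigr => i _.
rewrite (bigD1 i) //= eqxx mulr1n [X in _ + X]big1 ?addr0 => [|j ji].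
  by rewrite contractE !scalerA; congr (_ *: _); ring.
by rewrite eq_sym (negPf ji) mulr0n scale0r.
Qed.

Let adj_scalar (z : C) : adjmx (z%:M : 'M[C]_q) = (z^* )%:M.
Proof. by apply/matrixP => x y; rewrite adjmxE !mxE eq_sym rmorphMn. Qed.

Let hJ i : adjmx (J i) *m J i = 1%:M.
Proof.
rewrite adj_mul_rblk; transitivity ((\sum_h RtoC (c h))%:M : 'M[C]_q).
  rewrite [RHS]raddf_sum; apply: eq_bigr => h _.
  by rewrite /= blk_colK -(m_norm i) mulrC scalar_mxM adj_scalar.
by rewrite -RtoC_sum c1.
Qed.

Let hs : \sum_i RtoC d%:R^-1 *: (J i *m adjmx (J i)) =
  real_diag (fun x : 'I_(d * q) => c (mxtens_unindex x).1).
Proof.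
apply: blkP => h l; rewrite blk_diag -m_mix blk_sum [RHS]raddf_sum.
apply: eq_bigr => i _; rewrite blkZ blk_mul_adj !blk_colK adj_scalar.
by rewrite -scalar_mxM scale_scalar_mx.
Qed.

Let hD i : psd (D i).
Proof.
apply: psdZ; first by rewrite RtoC_ge0 ler0n.
by have := psd_mul_adj (adjmx (Ab i)); rewrite adjmxK.
Qed.

(** Here the sum runs over [x]: the phases [u] cancel, and orthonormality of the basis removes the
    terms with [i != j], leaving the mixture of the [m_i m_i^* (x) A_i^* A_i]. *)
Let KadjE : adjmx K *m K =
  \sum_i RtoC d%:R^-1 *: (J i *m D i *m adjmx (J i)).
Proof.
clearbody Ab; apply: blkP => h l; rewrite blk_mul blk_sum.
under eq_bigr do rewrite blk_adj !blk_mxK adjmx_sum mulmx_suml.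
rewrite exchange_big; apply: eq_bigr => i _ /=.
under eq_bigr do rewrite mulmx_sumr.
rewrite exchange_big /= (bigD1 i) //= [X in _ + X]big1 ?addr0 => [|j ji].
  rewrite blkZ blk_mul_adj rblk_mul !blk_colK adj_scalar.
  rewrite mul_scalar_mx mul_mx_scalar /D !scalerA.
  transitivity ((m i h * (m i l)^* * \sum_x b i x * (b i x)^* ) *:
      (adjmx (Ab i) *m Ab i)).
    rewrite mulr_sumr scaler_suml; apply: eq_bigr => x _.
    rewrite adjmxZ -scalemxAl -scalemxAr scalerA !rmorphM /= !conjCK.
    congr (_ *: _); transitivity (u x * (u x)^* *
       (m i h * (m i l)^* * (b i x * (b i x)^*))); first by ring.
    by rewrite u1 mul1r.
  rewrite b_rows eqxx; congr (_ *: _).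
  transitivity (RtoC (d%:R^-1 * d%:R) * (m i h * (m i l)^* )).
    by rewrite mulVf // RtoC1 mulr1 mul1r.
  by rewrite RtoCM; ring.
transitivity ((m i h * (m j l)^* * \sum_x b i x * (b j x)^* ) *:
    (adjmx (Ab i) *m Ab j)).
  rewrite mulr_sumr scaler_suml; apply: eq_bigr => x _.
  rewrite adjmxZ -scalemxAl -scalemxAr scalerA !rmorphM /= !conjCK.
  congr (_ *: _); transitivity (u x * (u x)^* *
     (m i h * (m j l)^* * (b i x * (b j x)^*))); first by ring.
  by rewrite u1 mul1r.
by rewrite b_rows eq_sym (negPf ji) mulr0 scale0r.
Qed.

Lemma vN_dephase : \tr X = 1 ->
  shannon c + \sum_i d%:R^-1 * vN_entropy (RtoC d%:R *: contract (b i) X) <=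
  vN_entropy (dephase X).
Proof.
move=> trX.
have := @vN_isometry_mix R 'I_d (d * q) q (fun=> d%:R^-1) J D _ _ hJ hD hs.
rewrite -KadjE -vN_swap dephaseE.
have d_ge0 (i : 'I_d) : 0 <= d%:R^-1 :> R by rewrite invr_ge0 ler0n.
move=> /(_ d_ge0).
have -> : \sum_i d%:R^-1 * vN_entropy (D i) =
    \sum_i d%:R^-1 * vN_entropy (RtoC d%:R *: contract (b i) X).
  apply: eq_bigr => i _; congr (_ * _).
  by rewrite /D vN_scale_swap ?ler0n // contractE.
set S := \sum_i _; move=> h; rewrite addrC -lerBrDr; apply: le_trans h _.
rewrite lerD2l /shannon opprK sum_mxtens; apply: ler_sum => h _.
under eq_bigr do rewrite mxtens_indexK /=.
(* The environment label [h] has distribution [c], since [|m_i h|^2 = c h] for every [i] and [X] has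
   trace one; hence the logarithmic term is [- shannon c]. *)
rewrite -mulr_suml; rewrite (_ : \sum_a _ = c h) //.
apply: (@RtoC_inj R); rewrite RtoC_sum.
transitivity (\tr (blk (adjmx K *m K) h h)).
  apply: eq_bigr => a _; rewrite -ge0_RtoC; first by rewrite [RHS]mxE.
  by apply: psd_diag_ge0; have := psd_mul_adj (adjmx K); rewrite adjmxK.
rewrite KadjE blk_sum (raddf_sum (@mxtrace C q)).
transitivity (\sum_i RtoC (c h) * \tr (adjmx (Ab i) *m Ab i)).
  apply: eq_bigr => i _; rewrite /= blkZ blk_mul_adj rblk_mul !blk_colK.
  rewrite adj_scalar mul_scalar_mx mul_mx_scalar /D !mxtraceZ.
  transitivity (RtoC (d%:R^-1 * d%:R) * (m i h * (m i h)^* ) *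
    \tr (adjmx (Ab i) *m Ab i)); first by rewrite RtoCM; ring.
  by rewrite mulVf // RtoC1 mul1r m_norm.
rewrite -mulr_sumr; rewrite (_ : \sum_i _ = 1) ?mulr1 //.
rewrite -trX mxtrace_mulC /X adj_mul_rblk raddf_sum /=.
transitivity (\sum_i \sum_x \sum_y ((b i x)^* * b i y) *
    \tr (adjmx (rblk A x) *m rblk A y)).
  apply: eq_bigr => i _; rewrite /Ab adjmx_sum mulmx_suml.
  rewrite (raddf_sum (@mxtrace C q)); apply: eq_bigr => x _ /=.
  rewrite mulmx_sumr (raddf_sum (@mxtrace C q)); apply: eq_bigr => y _ /=.
  by rewrite adjmxZ -scalemxAl -scalemxAr scalerA mxtraceZ.
rewrite exchange_big; apply: eq_bigr => x _ /=.
rewrite exchange_big (bigD1 x) //= [X in _ + X]big1 ?addr0 => [|y yx].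
  by rewrite -mulr_suml b_cols eqxx mul1r.
by rewrite -mulr_suml b_cols eq_sym (negPf yx) mul0r.
Qed.

End OneBasis.
End PhaseDamping.

(** * Roots of unity *)

Section Fourier.
Variable R : realType.
Local Notation C := (R[i]).

Lemma prim_root_existsC n : (0 < n)%N -> exists z : C, n.-primitive_root z.
Proof.
move=> n0; pose p : {poly C} := 'X^n - 1.
have [r Dp] := closed_field_poly_normal p.
rewrite (monicP _) ?monicXnsubC // scale1r in Dp.
have rn1 : all n.-unity_root r by apply/allP => z; rewrite -root_prod_XsubC -Dp.
have sz_r : (n < (size r).+1)%N.
  by rewrite -(size_prod_XsubC r id) -Dp size_XnsubC.
have [|z] := hasP (has_prim_root n0 rn1 _ sz_r); last by exists z.
by rewrite -separable_prod_XsubC -Dp cyclotomic.separable_Xn_sub_1 // pnatr_eq0 -lt0n.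
Qed.

Lemma prim_root_norm n (z : C) : n.-primitive_root z -> z * z^* = 1.
Proof.
move=> hz; have n0 := prim_order_gt0 hz.
rewrite -normCK; have : `|z| ^+ n = 1 by rewrite -normrX (prim_expr_order hz) normr1.
by move=> /eqP; rewrite pexpr_eq1 // => /eqP ->; rewrite expr1n.
Qed.

Lemma unit_normX (z : C) n : z * z^* = 1 -> z ^+ n * (z ^+ n)^* = 1.
Proof. by move=> h; rewrite rmorphXn -exprMn h expr1n. Qed.

Variables (d : nat) (w : C).
Hypothesis hw : d.-primitive_root w.
Let d0 : (0 < d)%N. Proof. exact: prim_order_gt0 hw. Qed.
Let dR : (d%:R : R) != 0. Proof. by rewrite pnatr_eq0 -lt0n. Qed.

Lemma RtoC_nat n : RtoC (n%:R : R) = n%:R.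
Proof. exact: (rmorph_nat (@RtoC R)). Qed.

(** A geometric sum whose ratio [z] satisfies [z ^+ d = 1] and equals [1] only if [x = y]. *)
Lemma fourier_orth (x y : 'I_d) :
  \sum_(h < d) w ^+ (h * x) * (w ^+ (h * y))^* = d%:R *+ (x == y).
Proof.
pose z := w ^+ x * (w ^+ y)^*.
have -> : \sum_(h < d) w ^+ (h * x) * (w ^+ (h * y))^* = \sum_(h < d) z ^+ h.
  apply: eq_bigr => h _; rewrite /z exprMn !rmorphXn /= -!exprM.
  by rewrite mulnC [(y * h)%N]mulnC.
have zE : z * w ^+ y = w ^+ x.
  by rewrite /z -mulrA [_^* * _]mulrC (unit_normX _ (prim_root_norm hw)) mulr1.
case: eqP => [xy|xy].
  have -> : z = 1 by rewrite /z xy (unit_normX _ (prim_root_norm hw)).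
  under eq_bigr do rewrite expr1n.
  by rewrite sumr_const card_ord mulr1n.
have z1 : z - 1 != 0.
  rewrite subr_eq0; apply/eqP => ze; apply: xy; apply: val_inj.
  move: zE; rewrite ze mul1r => /eqP; rewrite (eq_prim_root_expr hw).
  by rewrite !modn_small // => /eqP.
apply: (mulfI z1); rewrite -subrX1 mulr0n mulr0 /z exprMn.
by rewrite -exprM mulnC exprM (prim_expr_order hw) expr1n -rmorphXn -exprM
  mulnC exprM (prim_expr_order hw) expr1n rmorph1 mulr1 subrr.
Qed.

(* The spectrum of [lam * |e><e| + (1 - lam) / d] for a unit vector [e]. *)
Definition depol_spectrum (lam : R) (h : 'I_d) : R :=
  (1 - lam) / d%:R + lam *+ (h == 0%N :> nat).

Lemma depol_spectrum_ge0 lam h :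
  lam <= 1 -> 0 <= (1 - lam) / d%:R + lam -> 0 <= depol_spectrum lam h.
Proof.
rewrite /depol_spectrum; case: eqP => _ l1 l2; first by rewrite mulr1n.
by rewrite mulr0n addr0 divr_ge0 ?ler0n // subr_ge0.
Qed.

Lemma depol_spectrum_sum lam (V : lmodType C) (f : 'I_d -> V) :
  \sum_h RtoC (depol_spectrum lam h) *: f h =
  RtoC ((1 - lam) / d%:R) *: (\sum_h f h) + RtoC lam *: f (Ordinal d0).
Proof.
under eq_bigr do rewrite RtoCD scalerDl.
rewrite big_split /= -scaler_sumr; congr (_ + _).
rewrite (bigD1 (Ordinal d0)) //= mulr1n [X in _ + X]big1 ?addr0 // => h hh.
have -> : (h == 0%N :> nat) = false.
  by apply: contraNF hh => /eqP h0; apply/eqP/val_inj.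
by rewrite mulr0n RtoC0 scale0r.
Qed.

Lemma depol_spectrum_sum1 lam : \sum_h depol_spectrum lam h = 1.
Proof.
apply: (@RtoC_inj R); rewrite RtoC_sum RtoC1.
have := @depol_spectrum_sum lam (C^o) (fun=> 1).
rewrite /GRing.scale /= sumr_const card_ord mulr1 => h.
under eq_bigr do rewrite -[RtoC _]mulr1.
by rewrite h -RtoC_nat -RtoCM divfK // -RtoCD subrK.
Qed.

(** The flat part of the spectrum transforms to the diagonal term and its peak at [h = 0] to the
    constant. The formula serves twice: for the Gram matrix of the damping and for the correction by
    random phases. *)
Lemma depol_spectrum_fourier lam (x y : 'I_d) :
  \sum_h RtoC (depol_spectrum lam h) * (w ^+ (h * x) * (w ^+ (h * y))^* ) =
  RtoC lam + RtoC (1 - lam) *+ (x == y).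
Proof.
have := @depol_spectrum_sum lam (C^o)
  (fun h => w ^+ (h * x) * (w ^+ (h * y))^* ).
rewrite /GRing.scale /= => ->.
rewrite fourier_orth !mul0n !expr0 rmorph1 !mulr1 addrC; congr (_ + _).
case: eqP => _; last by rewrite !mulr0n mulr0.
by rewrite !mulr1n -RtoC_nat -RtoCM divfK.
Qed.

End Fourier.

(** * Averages over independent random cube roots of unity *)

Section PhaseMoment.
Variable R : realType.
Local Notation C := (R[i]).
Variables (d : nat) (z : C).
Hypothesis hz : 3.-primitive_root z.

Let phase (D : {ffun 'I_d -> 'Z_3}) x := z ^+ (D x).

(* If the index pairs differ, translating [D] at a suitable coordinate
   multiplies the summand by a nontrivial cube root of unity. *)
Lemma phase_moment x y a b :
  \sum_D (phase D x)^* * phase D y * (phase D a * (phase D b)^* ) =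
  (#|{ffun 'I_d -> 'Z_3}|%:R *+ ((x == y) && (a == b) || (x == a) && (y == b)) : C).
Proof.
have zz := prim_root_norm hz.
have pp D v : (phase D v)^* * phase D v = 1.
  by rewrite mulrC; exact: unit_normX.
case: (boolP (_ || _)) => [/orP[]/andP[/eqP <- /eqP <-]|/norP[n1 n2]].
- under eq_bigr do rewrite pp mul1r mulrC pp.
  by rewrite sumr_const.
- under eq_bigr do rewrite mulrACA pp mul1r mulrC pp.
  by rewrite sumr_const.
have z1 : z != 1 by rewrite -[z]expr1 -(prim_order_dvd hz).
have z'1 : z^* != 1 by rewrite fmorph_eq1.
(* Order three matters here: the square of [z^*] must differ from [1], which fails for signs. *)
have zz'1 : z^* * z^* != 1.
  rewrite -expr2 -rmorphXn fmorph_eq1.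
  by rewrite -(prim_order_dvd hz).
rewrite mulr0n.
pose f D := (phase D x)^* * phase D y * (phase D a * (phase D b)^* ).
rewrite -[LHS]/(\sum_D f D).
have shift v D u : phase (D + [ffun t => (t == v)%:R]) u = phase D u * z ^+ (u == v).
  rewrite /phase !ffunE; case: (u == v); last by rewrite addr0 mulr1.
  by rewrite /= modnDmr (expr_mod _ (prim_expr_order hz)) exprD.
suff [v [g g1 fg]] : exists v, exists2 g, g != 1 &
    forall D, f (D + [ffun t => (t == v)%:R]) = g * f D.
  have : \sum_D f D = g * \sum_D f D.
    rewrite {1}(reindex_inj (addIr [ffun t => (t == v)%:R])) mulr_sumr.
    by apply: eq_bigr => D _; rewrite fg.
  move=> /eqP; rewrite -subr_eq0 -{1}[\sum_D _]mul1r -mulrBl mulf_eq0 subr_eq0.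
  by rewrite eq_sym (negPf g1) => /eqP.
have fE v D : f (D + [ffun t => (t == v)%:R]) =
    (z ^+ (x == v))^* * z ^+ (y == v) * (z ^+ (a == v) * (z ^+ (b == v))^* ) * f D.
  by rewrite /f !shift !rmorphM /=; ring.
clearbody f.
(* In each case a coordinate is chosen whose phase does not cancel: [a] if [x = y], else [y] if
   [x = a], and [x] otherwise. *)
have [xy|xy] := eqVneq x y.
  exists a, z => // D; rewrite fE -xy eqxx; move: n1; rewrite xy eqxx /= eq_sym.
  move=> /negPf ->; rewrite expr0 expr1 rmorph1 mulr1; congr (_ * _).
  by rewrite [(_)^* * _]mulrC unit_normX // mul1r.
have [xa|xa] := eqVneq x a.
  have yb : y != b by move: n2; rewrite xa eqxx.
  exists y, z => // D; rewrite fE eqxx -xa (negPf xy) [b == y]eq_sym (negPf yb).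
  by rewrite !expr0 expr1 rmorph1 !(mul1r, mulr1).
have [bx|bx] := eqVneq b x.
  exists x, (z^* * z^* ) => // D.
  rewrite fE bx eqxx ![_ == x]eq_sym (negPf xy) (negPf xa).
  by rewrite !expr0 expr1 !(mul1r, mulr1).
exists x, z^* => // D; rewrite fE eqxx ![_ == x]eq_sym (negPf xy) (negPf xa).
by rewrite eq_sym (negPf bx) !expr0 expr1 rmorph1 !(mul1r, mulr1).
Qed.
End PhaseMoment.

(** * The depolarizing channel as a mixture of phase dampings *)

Section Twirl.
Variable R : realType.
Local Notation C := (R[i]).
Variables (d k : nat) (lam : R) (w z : C).
Hypothesis d2 : (2 <= d)%N.
Hypothesis hw : d.-primitive_root w.
Hypothesis hz : 3.-primitive_root z.
Hypothesis lam1 : lam <= 1.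
Hypothesis lam0 : 0 <= 1 + (d%:R ^+ 2 - 1) * lam.

Let T := {ffun 'I_d -> 'Z_3}.
Let N : R := #|T|%:R.
Let d0 : (0 < d)%N. Proof. exact: leq_trans d2. Qed.
Let dgt0 : 0 < d%:R :> R. Proof. by rewrite ltr0n. Qed.
Let dneq0 : (d%:R : R) != 0. Proof. by rewrite gt_eqF. Qed.
Let N0 : 0 < N.
Proof. by rewrite ltr0n; apply/card_gt0P; exists 0. Qed.

Let top : R := (1 - lam) / d%:R + lam.
Let r : R := lam / top.

Lemma depol_top_gt0 : 0 < top.
Proof.
have -> : top = (1 + (d%:R - 1) * lam) / d%:R by rewrite /top; field.
rewrite divr_gt0 //.
have e : (d%:R + 1) * (1 + (d%:R - 1) * lam) =
  (1 + (d%:R ^+ 2 - 1) * lam) + d%:R :> R by ring.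
by rewrite -(pmulr_rgt0 _ (ltr_wpDl (ltW dgt0) ltr01)) e ltr_wpDl.
Qed.

Lemma twirl_ratio_le1 : r <= 1.
Proof.
rewrite /r ler_pdivrMr ?depol_top_gt0 // mul1r /top lerDr.
by rewrite divr_ge0 ?subr_ge0 // ltW.
Qed.

(** The right side is the weight of the trivial phases in the random diagonal unitary. It is
    nonnegative because [1 + (d^2 - 1) lam] is, which for [lam <= 1] is complete positivity of the
    depolarizing map. *)
Lemma twirl_ratio_ge : 0 <= (1 - r) / d%:R + r.
Proof.
have t0 := depol_top_gt0; have t1 := lt0r_neq0 t0.
have -> : (1 - r) / d%:R + r = (1 + (d%:R ^+ 2 - 1) * lam) / (d%:R ^+ 2 * top).
  move: t1; rewrite /r /top => t1; field.
  rewrite dneq0 /=; apply: contra t1 => /eqP e; apply/eqP.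
  by apply: (mulIf dneq0); rewrite mul0r -e; field.
by rewrite divr_ge0 // mulr_ge0 ?ltW // exprn_gt0.
Qed.

(** Bras of the Fourier basis with coordinates twisted by cube roots of unity. For every [D] the
    basis is orthonormal and unbiased with the standard one. *)
Definition twisted_fourier (D : T) (i x : 'I_d) : C :=
  z ^+ (D x) * (w ^+ (i * x) * RtoC (sqrtr d%:R^-1)).

Let sq_d : RtoC (sqrtr d%:R^-1) * RtoC (sqrtr d%:R^-1) = RtoC (d%:R^-1 : R).
Proof. by rewrite -RtoCM -expr2 sqr_sqrtr // invr_ge0 ltW. Qed.

Let dd : RtoC (d%:R^-1) * d%:R = 1 :> C.
Proof. by rewrite -RtoC_nat -RtoCM mulVf. Qed.

Let zz n : z ^+ n * (z ^+ n)^* = 1.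
Proof. exact: unit_normX (prim_root_norm hz). Qed.

Lemma twisted_fourier_rows D i j :
  \sum_x twisted_fourier D i x * (twisted_fourier D j x)^* = (i == j)%:R.
Proof.
transitivity (RtoC d%:R^-1 * \sum_(x < d) w ^+ (x * i) * (w ^+ (x * j))^*).
  rewrite mulr_sumr; apply: eq_bigr => x _; rewrite /twisted_fourier.
  rewrite !rmorphM /= conj_RtoC -sq_d -[RHS]mul1r -(zz (D x)).
  by rewrite ![(x * _)%N]mulnC; ring.
by rewrite (fourier_orth hw) mulrnAr dd.
Qed.

Lemma twisted_fourier_cols D x y :
  \sum_i (twisted_fourier D i x)^* * twisted_fourier D i y = (x == y)%:R.
Proof.
transitivity ((z ^+ (D x))^* * z ^+ (D y) * RtoC d%:R^-1 *
    \sum_(i < d) w ^+ (i * y) * (w ^+ (i * x))^*).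
  rewrite mulr_sumr; apply: eq_bigr => i _; rewrite /twisted_fourier.
  by rewrite !rmorphM /= conj_RtoC -sq_d; ring.
rewrite (fourier_orth hw) eq_sym; case: eqP => [->|_]; last by rewrite !mulr0n mulr0.
by rewrite mulr1n -mulrA dd mulr1 mulrC zz.
Qed.

Lemma twisted_fourier_norm D i x :
  twisted_fourier D i x * (twisted_fourier D i x)^* = RtoC d%:R^-1.
Proof.
rewrite /twisted_fourier !rmorphM /= conj_RtoC -sq_d.
transitivity ((z ^+ D x * (z ^+ D x)^* ) * (w ^+ (i * x) * (w ^+ (i * x))^* ) *
  (RtoC (sqrtr d%:R^-1) * RtoC (sqrtr d%:R^-1))); first by ring.
by rewrite zz (unit_normX _ (prim_root_norm hw)) !mul1r.
Qed.

(** Averaging over [D] leaves only the two pairings of indices; on these the Fourier factors cancel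
    too, so each [i] contributes [N / d^2]. *)
Lemma twisted_fourier_moment x y a b :
  \sum_D \sum_i ((twisted_fourier D i x)^* * twisted_fourier D i y) *
      (twisted_fourier D i a * (twisted_fourier D i b)^* ) =
  RtoC (N / d%:R) *+ ((x == y) && (a == b) || (x == a) && (y == b)).
Proof.
pose q x y a b i := (w ^+ (i * x))^* * w ^+ (i * y) *
  (w ^+ (i * a) * (w ^+ (i * b))^* ).
transitivity (\sum_(i < d) RtoC d%:R^-1 * RtoC d%:R^-1 * q x y a b i *
    \sum_(D : T) ((z ^+ D x)^* * z ^+ D y * (z ^+ D a * (z ^+ D b)^* ))).
  rewrite exchange_big; apply: eq_bigr => i _ /=; rewrite mulr_sumr.
  apply: eq_bigr => D _; rewrite /q /twisted_fourier !rmorphM /= !conj_RtoC.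
  by rewrite -sq_d; ring.
rewrite -mulr_suml (phase_moment hz) -/T.
case: (boolP (_ || _)) => [h|_]; last by rewrite !mulr0n mulr0.
have ww n : (w ^+ n)^* * w ^+ n = 1.
  by rewrite mulrC (unit_normX _ (prim_root_norm hw)).
have q1 i : q x y a b i = 1.
  rewrite /q; case/orP: h => /andP[/eqP <- /eqP <-].
    by rewrite ww mul1r mulrC ww.
  by rewrite mulrACA ww mul1r mulrC ww.
under eq_bigr do rewrite q1 mulr1.
rewrite sumr_const card_ord !mulr1n -[_ *+ d]mulr_natr RtoCM /N RtoC_nat.
transitivity (RtoC d%:R^-1 * (RtoC d%:R^-1 * d%:R) * #|T|%:R : C); first by ring.
by rewrite dd mulr1 mulrC.
Qed.

Definition depolarize1 (X : 'M[C]_(d * k)) : 'M[C]_(d * k) :=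
  blk_mx (fun x y => RtoC lam *: blk X x y +
    RtoC ((1 - lam) / d%:R) *: (ptrace1 X *+ (x == y))).

Let u (l x : 'I_d) : C := w ^+ (l * x).

(** In the fourth moment, one pairing turns the diagonal blocks into the partial trace and the other
    keeps the off-diagonal blocks. *)
Lemma twirl_contract (X : 'M[C]_(d * k)) x y :
  \sum_D RtoC N^-1 *: (\sum_i ((twisted_fourier D i x)^* *
      twisted_fourier D i y) *: contract (twisted_fourier D i) X) =
  RtoC d%:R^-1 *: (if x == y then ptrace1 X else blk X x y).
Proof.
transitivity (\sum_a \sum_b (RtoC N^-1 * \sum_D \sum_i
    (((twisted_fourier D i x)^* * twisted_fourier D i y) *
    (twisted_fourier D i a * (twisted_fourier D i b)^* ))) *: blk X a b).
  under [RHS]eq_bigr do under eq_bigr do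
    (rewrite mulr_sumr scaler_suml; under eq_bigr do
      rewrite mulr_sumr scaler_suml).
  under [RHS]eq_bigr do rewrite exchange_big /=.
  rewrite [RHS]exchange_big; apply: eq_bigr => D _ /=.
  under [RHS]eq_bigr do rewrite exchange_big /=.
  rewrite [RHS]exchange_big scaler_sumr; apply: eq_bigr => i _ /=.
  rewrite /contract !scaler_sumr; apply: eq_bigr => a _.
  rewrite !scaler_sumr; apply: eq_bigr => b _.
  by rewrite !scalerA !mulrA.
have NN : RtoC N^-1 * RtoC (N / d%:R) = RtoC d%:R^-1.
  by rewrite -RtoCM mulrA mulVf ?mul1r // gt_eqF.
transitivity (\sum_a \sum_b (RtoC d%:R^-1 *+
    ((x == y) && (a == b) || (x == a) && (y == b))) *: blk X a b).
  apply: eq_bigr => a _; apply: eq_bigr => b _.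
  by rewrite twisted_fourier_moment mulrnAr NN.
case: eqP => [xy|xy] /=.
  rewrite ptrace1E scaler_sumr; apply: eq_bigr => a _.
  rewrite (bigD1 a) //= eqxx mulr1n [X in _ + X]big1 ?addr0 // => b ba.
  rewrite eq_sym (negPf ba) -xy /=.
  have [xa|] := eqVneq x a; last by rewrite mulr0n scale0r.
  by rewrite xa eq_sym (negPf ba) mulr0n scale0r.
rewrite (bigD1 x) //= eqxx [X in _ + X]big1 ?addr0 => [|a ax].
  rewrite (bigD1 y) //= eqxx mulr1n [X in _ + X]big1 ?addr0 // => b yb.
  by rewrite eq_sym (negPf yb) mulr0n scale0r.
by apply: big1 => b _; rewrite eq_sym (negPf ax) mulr0n scale0r.
Qed.

(* Averaging over [D] scales the off-diagonal blocks by [top] instead of [lam];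
   the phases [u l], weighted by the spectrum for [r = lam / top], correct
   this. *)
Lemma twirl_dephase (X : 'M[C]_(d * k)) :
  \sum_(D : T) \sum_l RtoC (N^-1 * depol_spectrum r l) *:
    dephase lam (twisted_fourier D) (u l) X = depolarize1 X.
Proof.
apply: blkP => x y; rewrite blk_mxK blk_sum.
pose E D := RtoC lam *: blk X x y +
    RtoC (1 - lam) *: \sum_i ((twisted_fourier D i x)^* *
      twisted_fourier D i y) *: contract (twisted_fourier D i) X.
(* For every [D], the unitary [u l] only multiplies block [(x, y)] by a phase, whose weighted sum
   over [l] is the Fourier transform of the spectrum for [r]. *)
transitivity ((RtoC r + RtoC (1 - r) *+ (x == y)) *:
    \sum_(D : T) RtoC N^-1 *: E D).
  rewrite scaler_sumr; apply: eq_bigr => D _.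
  rewrite blk_sum -(depol_spectrum_fourier hw) scaler_suml.
  apply: eq_bigr => l _; rewrite blkZ blk_mxK !scalerA -/(E D).
  by congr (_ *: _); rewrite RtoCM /u; ring.
have NT : \sum_(D : T) RtoC N^-1 = 1.
  by rewrite sumr_const -mulr_natr -RtoC_nat -RtoCM mulVf // gt_eqF.
have -> : \sum_(D : T) RtoC N^-1 *: E D = RtoC lam *: blk X x y +
    RtoC (1 - lam) *: (RtoC d%:R^-1 *: (if x == y then ptrace1 X else blk X x y)).
  under eq_bigr do rewrite /E scalerDr.
  rewrite big_split /=; congr (_ + _).
    by rewrite -scaler_suml NT scale1r.
  rewrite -twirl_contract scaler_sumr; apply: eq_bigr => D _.
  by rewrite !scalerA mulrC.
rewrite scalerA -RtoCM; case: eqP => [<-|_].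
  by rewrite !mulr1n -RtoCD addrC subrK scale1r.
rewrite !mulr0n scaler0 !addr0 -scalerDl scalerA -RtoCD -RtoCM; congr (RtoC _ *: _).
rewrite [_ + _](_ : _ = top); last by rewrite addrC.
by rewrite /r divfK // gt_eqF // depol_top_gt0.
Qed.

Let r_spectrum_ge0 (l : 'I_d) : 0 <= depol_spectrum r l.
Proof.
exact: (@depol_spectrum_ge0 R d r l twirl_ratio_le1 twirl_ratio_ge).
Qed.

Let c := depol_spectrum (d := d) lam.
Let c_ge0 i : 0 <= c i.
Proof. by apply: depol_spectrum_ge0 => //; exact: ltW depol_top_gt0. Qed.

(** Square roots of the spectrum times Fourier characters: the Fourier transform of the spectrum
    gives their Gram matrix, and Fourier orthogonality makes their uniform mixture diagonal. *)
Let m (i l : 'I_d) : C := RtoC (sqrtr (c l)) * w ^+ (l * i).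
Let ww n : w ^+ n * (w ^+ n)^* = 1.
Proof. exact: unit_normX (prim_root_norm hw). Qed.

Let sc l : RtoC (sqrtr (c l)) * RtoC (sqrtr (c l)) = RtoC (c l).
Proof. by rewrite -RtoCM -expr2 sqr_sqrtr. Qed.

Let m_norm i l : m i l * (m i l)^* = RtoC (c l).
Proof. by rewrite /m rmorphM /= conj_RtoC mulrACA sc ww mulr1. Qed.

Let m_gram i j :
  \sum_l (m i l)^* * m j l = RtoC lam + RtoC (1 - lam) *+ (i == j).
Proof.
rewrite eq_sym -(depol_spectrum_fourier hw); apply: eq_bigr => l _.
by rewrite /m rmorphM /= conj_RtoC mulrACA sc [(_)^* * _]mulrC.
Qed.

Let m_mix l l' :
  \sum_i RtoC d%:R^-1 * (m i l * (m i l')^* ) = RtoC (c l) *+ (l == l').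
Proof.
transitivity (RtoC d%:R^-1 * (RtoC (sqrtr (c l)) * RtoC (sqrtr (c l'))) *
    \sum_(i < d) w ^+ (i * l) * (w ^+ (i * l'))^*).
  rewrite mulr_sumr; apply: eq_bigr => i _.
  rewrite /m rmorphM /= conj_RtoC [(l * i)%N]mulnC [(l' * i)%N]mulnC.
  by ring.
rewrite (fourier_orth hw); case: eqP => [->|_]; last by rewrite !mulr0n mulr0.
by rewrite sc !mulr1n mulrAC dd mul1r.
Qed.

Let dephase_psd (X : 'M[C]_(d * k)) D l : psd X ->
  psd (dephase lam (twisted_fourier D) (u l) X).
Proof.
move=> /psd_sqrt[A ->].
rewrite -(dephaseE (u l) (twisted_fourier_cols D) m_gram A).
exact: psd_mul_adj.
Qed.

Lemma depolarize1_psd X : psd X -> psd (depolarize1 X).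
Proof.
move=> hX; rewrite -twirl_dephase.
apply: psd_sum => D; apply: psd_sum => l; apply: psdZ; last exact: dephase_psd.
by rewrite RtoC_ge0 mulr_ge0 // invr_ge0 ltW.
Qed.

(** Concavity applied to the mixture of phase dampings. The bound for each of them does not depend
    on the phases [u l], so their weights sum out and a uniform average over [D] and [i] remains. *)
Lemma vN_depolarize1 (X : 'M[C]_(d * k)) : density X ->
  shannon c + \sum_(t : T * 'I_d) (N * d%:R)^-1 *
    vN_entropy (RtoC d%:R *: contract (twisted_fourier t.1 t.2) X) <=
  vN_entropy (depolarize1 X).
Proof.
move=> [hX trX]; have [A eA] := psd_sqrt hX.
have uu l x : u l x * (u l x)^* = 1 by exact: ww.
have main D l : shannon c + \sum_i d%:R^-1 *
    vN_entropy (RtoC d%:R *: contract (twisted_fourier D i) X) <=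
    vN_entropy (dephase lam (twisted_fourier D) (u l) X).
  rewrite eA; apply: (vN_dephase d0 (depol_spectrum_sum1 hw lam) (uu l)
    (twisted_fourier_rows D) (twisted_fourier_cols D) m_norm m_gram m_mix).
  by rewrite -eA.
have w0 (p : T * 'I_d) : 0 <= N^-1 * depol_spectrum r p.2.
  by rewrite mulr_ge0 // invr_ge0 ltW.
have NT : \sum_(D : T) N^-1 = 1 :> R.
  by rewrite sumr_const -mulr_natr mulVf // gt_eqF.
have wsum1 : \sum_(l < d) N^-1 * depol_spectrum r l = N^-1.
  by rewrite -mulr_sumr (depol_spectrum_sum1 hw) mulr1.
have wsum : \sum_(p : T * 'I_d) N^-1 * depol_spectrum r p.2 = 1.
  rewrite -(pair_bigA _ (fun D l => N^-1 * depol_spectrum r l)) /=.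
  under eq_bigr do rewrite wsum1.
  exact: NT.
have Ppsd (p : T * 'I_d) : psd (dephase lam (twisted_fourier p.1) (u p.2) X).
  exact: dephase_psd.
have := vN_concave w0 wsum Ppsd.
rewrite -(pair_bigA _ (fun D l => RtoC (N^-1 * depol_spectrum r l) *:
  dephase lam (twisted_fourier D) (u l) X)) /= twirl_dephase; apply: le_trans.
apply: (@le_trans _ _ (\sum_(p : T * 'I_d) N^-1 * depol_spectrum r p.2 *
   (shannon c + \sum_i d%:R^-1 *
    vN_entropy (RtoC d%:R *: contract (twisted_fourier p.1 i) X)))); last first.
  by apply: ler_sum => p _; rewrite ler_wpM2l.
under [leRHS]eq_bigr do rewrite mulrDr.
rewrite big_split /= -mulr_suml wsum mul1r lerD2l.
rewrite -(pair_bigA _ (fun D l => N^-1 * depol_spectrum r l * \sum_i d%:R^-1 *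
    vN_entropy (RtoC d%:R *: contract (twisted_fourier D i) X))) /=.
rewrite -(pair_bigA _ (fun D i => (N * d%:R)^-1 *
    vN_entropy (RtoC d%:R *: contract (twisted_fourier D i) X))) /=.
apply: ler_sum => D _; rewrite -mulr_suml wsum1 mulr_sumr; apply: ler_sum => i _.
by rewrite invfM mulrA.
Qed.

End Twirl.

(** * Maps acting on one tensor factor *)

Section Channels.
Variable R : realType.
Local Notation C := (R[i]).

Section LinearMap.
Variables (n m : nat) (Psi : 'M[C]_n -> 'M[C]_m).
Hypothesis hPsi : linear_map Psi.

Lemma linear_map0 : Psi 0 = 0.
Proof.
have := hPsi 1 0 0; rewrite !scale1r addr0 => /eqP.
by rewrite -subr_eq0 opprD addNKr oppr_eq0 => /eqP.
Qed.

Lemma linear_mapZ a A : Psi (a *: A) = a *: Psi A.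
Proof. by rewrite -[a *: A]addr0 hPsi linear_map0 addr0. Qed.

Lemma linear_map_sum (I : finType) (A : I -> 'M[C]_n) :
  Psi (\sum_i A i) = \sum_i Psi (A i).
Proof.
have PsiD : {morph Psi : X Y / X + Y}.
  by move=> X Y; rewrite -{1}[X]scale1r hPsi scale1r.
exact: (big_morph Psi PsiD linear_map0).
Qed.

End LinearMap.

Lemma blk_tensor_map n1 m1 n2 m2 (Phi : 'M[C]_n1 -> 'M[C]_m1)
    (Psi : 'M[C]_n2 -> 'M[C]_m2) X x y : linear_map Psi ->
  blk (tensor_map Phi Psi X) x y =
  \sum_i \sum_j (Phi (delta_mx i j)) x y *: Psi (blk X i j).
Proof.
move=> hPsi; rewrite /tensor_map blk_sum; apply: eq_bigr => i _.
rewrite blk_sum; apply: eq_bigr => j _.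
rewrite [blk X i j]matrix_sum_delta (linear_map_sum hPsi).
rewrite blk_sum scaler_sumr; apply: eq_bigr => a _.
rewrite blk_sum (linear_map_sum hPsi) scaler_sumr; apply: eq_bigr => b _.
rewrite blkZ (linear_mapZ hPsi) [blk X i j a b]mxE scalerA mulrC -scalerA; congr (_ *: _).
by apply/matrixP => e f; rewrite [LHS]mxE tensmxE mxE.
Qed.

Lemma blk_tensor_id n1 n2 m2 (Psi : 'M[C]_n2 -> 'M[C]_m2) X (x y : 'I_n1) :
  linear_map Psi -> blk (tensor_map id Psi X) x y = Psi (blk X x y).
Proof.
move=> hPsi; rewrite blk_tensor_map // (bigD1 x) //= (bigD1 y) //=.
rewrite mxE !eqxx scale1r big1 ?addr0 => [|j jy]; last first.
  by rewrite mxE [y == j]eq_sym (negPf jy) andbF scale0r.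
rewrite big1 ?addr0 // => i ix; apply: big1 => j _.
by rewrite mxE [x == i]eq_sym (negPf ix) scale0r.
Qed.

Lemma contract_tensor_id n1 n2 m2 (Psi : 'M[C]_n2 -> 'M[C]_m2) X (b : 'I_n1 -> C) :
  linear_map Psi -> contract b (tensor_map id Psi X) = Psi (contract b X).
Proof.
move=> hPsi; rewrite /contract.
rewrite (linear_map_sum hPsi); apply: eq_bigr => x _.
rewrite (linear_map_sum hPsi); apply: eq_bigr => y _.
by rewrite blk_tensor_id // (linear_mapZ hPsi).
Qed.

Lemma tensor_depolarizing d k p (Omega : 'M[C]_k -> 'M[C]_k) X :
  linear_map Omega -> tensor_map (depolarizing d p) Omega X =
  depolarize1 (1 - p) (tensor_map id Omega X).
Proof.
move=> hO; apply: blkP => x y; rewrite blk_tensor_map // blk_mxK.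
transitivity (\sum_i \sum_j (RtoC (1 - p) * (delta_mx i j : 'M_d) x y) *:
    Omega (blk X i j) + \sum_i \sum_j (RtoC (p / d%:R) *
    ((i == j)%:R * (x == y)%:R)) *: Omega (blk X i j)).
  rewrite -big_split; apply: eq_bigr => i _; rewrite -big_split.
  apply: eq_bigr => j _ /=; rewrite -scalerDl; congr (_ *: _).
  rewrite /depolarizing !mxE; congr (_ + _).
  rewrite -mulrA; congr (_ * _); rewrite -mulr_natr mul1r; congr (_ * _).
  rewrite /mxtrace; under eq_bigr do rewrite mxE.
  have [->|ij] := eqVneq i j.
    by rewrite (bigD1 j) //= eqxx big1 ?addr0 // => l /negPf ->.
  apply: big1 => l _; have [->|//] := eqVneq l i.
  by rewrite (negPf ij).
congr (_ + _).
  under eq_bigr do under eq_bigr do rewrite -scalerA.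
  under eq_bigr do rewrite -scaler_sumr.
  rewrite -scaler_sumr; congr (_ *: _).
  by have := blk_tensor_map id X x y hO; rewrite blk_tensor_id // => ->.
have -> : (1 - (1 - p)) / d%:R = p / d%:R by rewrite opprB addrCA subrr addr0.
rewrite ptrace1E -[X in _ = _ *: X]scaler_nat scalerA scaler_sumr.
apply: eq_bigr => i _; rewrite blk_tensor_id // (bigD1 i) //= eqxx mul1r.
rewrite big1 ?addr0 // => j ji.
by rewrite eq_sym (negPf ji) mul0r mulr0 scale0r.
Qed.

Lemma tensor_id_trace n1 n2 (Psi : 'M[C]_n2 -> 'M[C]_n2) (X : 'M[C]_(n1 * n2)) :
  linear_map Psi -> trace_preserving Psi ->
  \tr (tensor_map id Psi X) = \tr X.
Proof.
move=> hPsi trPsi; rewrite !mxtrace_blk; apply: eq_bigr => x _.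
by rewrite blk_tensor_id // trPsi.
Qed.

Lemma channel_density n (Psi : 'M[C]_n -> 'M[C]_n) A :
  channel Psi -> density A -> density (Psi A).
Proof.
case=> hl hcp htp [hA trA]; split; last by rewrite htp.
have [B eB] := psd_sqrt hA.
(* Complete positivity is used with a one-dimensional ancilla, [A] being viewed as a single
   block. *)
pose X : 'M[C]_(1 * n, 1 * n) := blk_mx (fun _ _ => A).
have eX : X = blk_col (fun=> B) *m adjmx (blk_col (fun=> B)).
  by apply: blkP => x y; rewrite blk_mxK blk_mul_adj !blk_colK.
have hX : psd X by rewrite eX; exact: psd_mul_adj.
have := contract_psd (fun=> 1) (hcp 1%N X hX).
rewrite /contract !big_ord1 blk_tensor_id // blk_mxK.
by rewrite rmorph1 mulr1 scale1r.
Qed.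

(** * Unitaries on the first tensor factor *)

Section LocalUnitary.
Variables (d k : nat) (U : 'M[C]_d).
Hypothesis hU : U *m adjmx U = 1%:M.

Let V : 'M[C]_(d * k) := blk_mx (fun x a => (U x a)%:M).

Let VadjE x a : blk (adjmx V) x a = ((U a x)^* )%:M.
Proof.
rewrite blk_adj blk_mxK.
by apply/matrixP => i j; rewrite adjmxE !mxE eq_sym rmorphMn.
Qed.

Definition rotate (X : 'M[C]_(d * k)) := V *m X *m adjmx V.

Lemma blk_rotate X x y : blk (rotate X) x y =
  \sum_a \sum_b (U x a * (U y b)^* ) *: blk X a b.
Proof.
rewrite /rotate blk_mul exchange_big; apply: eq_bigr => b _ /=.
rewrite blk_mul mulmx_suml.
apply: eq_bigr => a _; rewrite VadjE blk_mxK mul_scalar_mx mul_mx_scalar.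
by rewrite scalerA mulrC.
Qed.

Lemma local_unitary : V *m adjmx V = 1%:M.
Proof.
apply: blkP => x y; rewrite blk_mul.
under eq_bigr do rewrite VadjE blk_mxK -scalar_mxM.
rewrite -[LHS]raddf_sum.
have := congr1 (fun M : 'M_d => M x y) hU; rewrite /= !mxE => h.
rewrite (_ : \sum_a _ = (x == y)%:R); last first.
  by rewrite -h; apply: eq_bigr => a _; rewrite adjmxE.
apply/matrixP => i j; rewrite !mxE (inj_eq (can_inj (@mxtens_indexK d k))).
by rewrite xpair_eqE; case: (x == y); case: (i == j); rewrite ?mul0rn.
Qed.

Lemma vN_rotate X : psd X -> vN_entropy (rotate X) = vN_entropy X.
Proof. by move=> hX; exact: vN_unitary_conj hX local_unitary. Qed.

Lemma rotate_density X : density X -> density (rotate X).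
Proof.
case=> hX trX; split; first exact: psd_conj.
by rewrite /rotate mxtrace_mulC mulmxA (mulmx1C local_unitary) mul1mx.
Qed.

Let U_cols a b : \sum_x U x a * (U x b)^* = (a == b)%:R.
Proof.
have := congr1 (fun M : 'M_d => M b a) (mulmx1C hU); rewrite /= !mxE eq_sym.
by move=> <-; apply: eq_bigr => x _; rewrite adjmxE mulrC.
Qed.

Lemma ptrace1_rotate X : ptrace1 (rotate X) = ptrace1 X.
Proof.
rewrite !ptrace1E; under eq_bigr do rewrite blk_rotate.
rewrite exchange_big; apply: eq_bigr => a _ /=.
rewrite exchange_big (bigD1 a) //= [X in _ + X]big1 ?addr0 => [|b ba].
  by rewrite -scaler_suml U_cols eqxx scale1r.
by rewrite -scaler_suml U_cols eq_sym (negPf ba) scale0r.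
Qed.

Lemma ptrace2_rotate X : ptrace2 (rotate X) = U *m ptrace2 X *m adjmx U.
Proof.
apply/matrixP => x y; rewrite ptrace2E blk_rotate.
rewrite (raddf_sum (@mxtrace C k)) /=.
under eq_bigr do rewrite (raddf_sum (@mxtrace C k)) /=.
rewrite exchange_big mxE; apply: eq_bigr => b _ /=.
rewrite mxE mulr_suml; apply: eq_bigr => a _.
by rewrite mxtraceZ ptrace2E adjmxE; ring.
Qed.

(** Covariance of the depolarizing channel: a unitary on the first factor leaves the partial trace
    over it unchanged and fixes the identity on it. *)
Lemma rotate_depolarize1 lam X :
  rotate (depolarize1 lam X) = depolarize1 lam (rotate X).
Proof.
apply: blkP => x y; rewrite blk_rotate blk_mxK blk_rotate ptrace1_rotate.
transitivity (\sum_a \sum_b (RtoC lam *: ((U x a * (U y b)^* ) *: blk X a b) +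
   (RtoC ((1 - lam) / d%:R) * (U x a * (U y b)^* ) *+ (a == b)) *: ptrace1 X)).
  apply: eq_bigr => a _; apply: eq_bigr => b _.
  rewrite blk_mxK scalerDr !scalerA; congr (_ + _).
    by rewrite mulrC.
  by rewrite -scalerMnr scalerMnl mulrC.
under eq_bigr do rewrite big_split /= -scaler_sumr.
rewrite big_split /= -scaler_sumr; congr (_ + _).
transitivity (\sum_a (RtoC ((1 - lam) / d%:R) * (U x a * (U y a)^* )) *: ptrace1 X).
  apply: eq_bigr => a _; rewrite (bigD1 a) //= eqxx mulr1n.
  rewrite big1 ?addr0 // => b ba.
  by rewrite eq_sym (negPf ba) mulr0n scale0r.
rewrite -scaler_suml -mulr_sumr -scalerA; congr (_ *: _).
have := congr1 (fun M : 'M_d => M x y) hU; rewrite /= !mxE => h.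
rewrite (_ : \sum_a _ = (x == y)%:R) ?scaler_nat //.
by rewrite -h; apply: eq_bigr => a _; rewrite adjmxE.
Qed.

Lemma contract_rotate X (b : 'I_d -> C) :
  contract b (rotate X) = contract (fun a => \sum_x b x * U x a) X.
Proof.
rewrite /contract.
transitivity (\sum_x \sum_y \sum_a \sum_e
   (b x * (b y)^* * (U x a * (U y e)^* )) *: blk X a e).
  apply: eq_bigr => x _; apply: eq_bigr => y _; rewrite blk_rotate.
  rewrite scaler_sumr; apply: eq_bigr => a _.
  by rewrite scaler_sumr; apply: eq_bigr => e _; rewrite scalerA.
under eq_bigr do rewrite exchange_big /=.
rewrite exchange_big; apply: eq_bigr => a _ /=.
under eq_bigr do rewrite exchange_big /=.
rewrite exchange_big; apply: eq_bigr => e _ /=.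
rewrite mulr_suml scaler_suml; apply: eq_bigr => x _.
rewrite rmorph_sum mulr_sumr scaler_suml; apply: eq_bigr => y _ /=.
by rewrite rmorphM /=; congr (_ *: _); ring.
Qed.

End LocalUnitary.

End Channels.

(** * Convex roofs *)

Section Depolarizing.
Variable R : realType.
Local Notation C := (R[i]).

Lemma eigdec_depolarizing d p (A U : 'M[C]_d) l : eigdec A U l ->
  eigdec (depolarizing d p A) U
    (fun i => (1 - p) * l i + p / d%:R * \sum_j l j).
Proof.
move=> hA; have [hU eA] := hA; split=> //.
rewrite /depolarizing (eigdec_trace hA) -RtoCM.
have -> : real_diag (fun i => (1 - p) * l i + p / d%:R * \sum_j l j) =
    RtoC (1 - p) *: real_diag l + (RtoC (p / d%:R * \sum_j l j))%:M.
  apply/matrixP => i j; rewrite real_diagE !mxE.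
  by case: eqP => _; rewrite ?mulr0n ?mulr0 ?addr0 // !mulr1n !RtoCD !RtoCM ?RtoCD.
rewrite mulmxDr mulmxDl -scalemxAr -scalemxAl -eA; congr (_ + _).
by rewrite mul_mx_scalar -scalemxAl (mulmx1C hU).
Qed.

Lemma shannon_rank1_mix d a b (x y : 'I_d) :
  shannon (fun j => a * (j == x)%:R + b) = shannon (fun j => a * (j == y)%:R + b) :> R.
Proof.
rewrite /shannon (reindex_inj (@perm_inj _ (tperm x y))) /=; congr (- _).
apply: eq_bigr => j _.
have -> // : (tperm x y j == x) = (j == y).
by rewrite -{2}(tpermR x y) (inj_eq perm_inj).
Qed.

Variables (d : nat) (p : R).
Hypothesis d2 : (2 <= d)%N.
Hypothesis hp : 0 <= p <= d%:R ^+ 2 / (d%:R ^+ 2 - 1).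

Let d0 : (0 < d)%N. Proof. exact: leq_trans d2. Qed.
Let dgt0 : 0 < d%:R :> R. Proof. by rewrite ltr0n. Qed.
Let dneq0 : (d%:R : R) != 0. Proof. by rewrite gt_eqF. Qed.

Lemma depol_parameter_le1 : 1 - p <= 1.
Proof. by case/andP: hp => p0 _; rewrite gerBl. Qed.

Lemma depol_parameter_ge : 0 <= 1 + (d%:R ^+ 2 - 1) * (1 - p).
Proof.
case/andP: hp => _; rewrite ler_pdivlMr; last first.
  by rewrite subr_gt0 exprn_egt1 // ltr1n.
rewrite -subr_ge0; congr (0 <= _); ring.
Qed.

(** The expression is affine in [l], so it suffices to look at [l = 0] and [l = 1], which give the
    eigenvalues of a depolarized pure state. *)
Lemma depol_eig_ge0 (l : R) : 0 <= l <= 1 -> 0 <= (1 - p) * l + p / d%:R.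
Proof.
case/andP: (hp) => p0 _ /andP[l0 l1].
have t0 := depol_top_gt0 d2 depol_parameter_ge.
have -> : (1 - p) * l + p / d%:R =
    l * ((1 - (1 - p)) / d%:R + (1 - p)) + (1 - l) * (p / d%:R) by field.
by rewrite addr_ge0 // mulr_ge0 ?subr_ge0 ?divr_ge0 // ltW.
Qed.

Lemma vN_depolarizing_ge0 A : density A -> 0 <= vN_entropy (depolarizing d p A).
Proof.
move=> hA; have [l0 l1] := density_eigval hA.
have [/psd_eigdec[dA _] _] := hA; have dP := eigdec_depolarizing p dA.
rewrite l1 mulr1 in dP.
have e0 i : 0 <= (1 - p) * eigval A i + p / d%:R.
  apply: depol_eig_ge0; rewrite l0 /= -l1 (bigD1 i) //= lerDl.
  by rewrite sumr_ge0.
rewrite (vN_eigdec dP e0); apply: shannon_ge0 => //.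
rewrite big_split /= -mulr_sumr l1 mulr1 sumr_const card_ord -[_ *+ d]mulr_natr.
by rewrite divfK // subrK.
Qed.

Lemma vN_depolarizing_pure (U : 'M[C]_d) x : U *m adjmx U = 1%:M ->
  vN_entropy (depolarizing d p (adjmx (row x U) *m row x U)) =
  shannon (depol_spectrum (d := d) (1 - p)).
Proof.
move=> hU; have dA : eigdec (adjmx (row x U) *m row x U) U (fun j => (j == x)%:R).
  split=> //; apply/matrixP => a b; rewrite -mulmxA !mxE big_ord1 (bigD1 x) //=.
  rewrite real_diag_mulmxE eqxx RtoC1 mul1r !adjmxE !mxE.
  rewrite big1 ?addr0 // => y yx.
  by rewrite real_diag_mulmxE (negPf yx) RtoC0 mul0r mulr0.
have s1 : \sum_(j < d) (j == x)%:R = 1 :> R.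
  by rewrite (bigD1 x) //= eqxx big1 ?addr0 // => j /negPf ->.
have dP := eigdec_depolarizing p dA; rewrite s1 mulr1 in dP.
rewrite (vN_eigdec dP) => [|i]; last first.
  by apply: depol_eig_ge0; case: (i == x); rewrite /= ?lexx ler01.
rewrite (shannon_rank1_mix _ _ x (Ordinal d0)) /shannon /depol_spectrum.
congr (- _); apply: eq_bigr => j _.
have -> : (j == Ordinal d0) = (j == 0%N :> nat) by [].
by rewrite mulr_natr addrC opprB addrCA subrr addr0.
Qed.

End Depolarizing.

(** * Upper bounds from explicit decompositions *)

Section ConvexRoof.
Variable R : realType.
Local Notation C := (R[i]).

Lemma out_entropy_values_fin n m (Psi : 'M[C]_n -> 'M[C]_m) s (I : finType)
    (pi : I -> R) (ss : I -> 'M[C]_n) :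
  (forall i, 0 <= pi i) -> \sum_i pi i = 1 -> (forall i, density (ss i)) ->
  s = \sum_i RtoC (pi i) *: ss i ->
  out_entropy_values Psi s (\sum_i pi i * vN_entropy (Psi (ss i))).
Proof.
move=> h0 h1 hd hs; exists #|I|, (pi \o enum_val), (ss \o enum_val); split=> /=.
- by move=> j; exact: h0.
- by rewrite -h1 [RHS](reindex_onto enum_val enum_rank) //=;
    [apply: eq_bigl => j; rewrite enum_valK eqxx|move=> i _; exact: enum_rankK].
- by move=> j; exact: hd.
- by rewrite hs [LHS](reindex_onto enum_val enum_rank) //=;
    [apply: eq_bigl => j; rewrite enum_valK eqxx|move=> i _; exact: enum_rankK].
- by rewrite [LHS](reindex_onto enum_val enum_rank) //=;
    [apply: eq_bigl => j; rewrite enum_valK eqxx|move=> i _; exact: enum_rankK].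
Qed.

(** Nonnegative output entropies bound the set of values from below, so its infimum lies below each
    of its elements. *)
Lemma H_chan_le n m (Psi : 'M[C]_n -> 'M[C]_m) s (I : finType)
    (pi : I -> R) (ss : I -> 'M[C]_n) :
  (forall A, density A -> 0 <= vN_entropy (Psi A)) ->
  (forall i, 0 <= pi i) -> \sum_i pi i = 1 -> (forall i, density (ss i)) ->
  s = \sum_i RtoC (pi i) *: ss i ->
  H_chan Psi s <= \sum_i pi i * vN_entropy (Psi (ss i)).
Proof.
move=> hPsi h0 h1 hd hs; apply: ge_inf; last exact: out_entropy_values_fin.
exists 0 => x [J [q [tt [q0 _ ht _ ->]]]].
by apply: sumr_ge0 => j _; rewrite mulr_ge0 // hPsi.
Qed.

Lemma ptrace2_density d k (X : 'M[C]_(d * k)) : density X -> density (ptrace2 X).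
Proof.
case=> hX trX; split.
  move=> v; have := psd_trace_ge0 (contract_psd (fun x => v 0 x) hX).
  rewrite contract_trace; congr (0 <= _).
  rewrite exchange_big mxE; apply: eq_bigr => y _ /=.
  by rewrite adjmxE mxE mulr_suml; apply: eq_bigr => x _; rewrite mulrAC.
rewrite -trX mxtrace_blk; apply: eq_bigr => x _; exact: ptrace2E.
Qed.

Lemma ptrace1_sum d k (I : finType) (c : I -> C) (X : I -> 'M[C]_(d * k)) :
  ptrace1 (\sum_i c i *: X i) = \sum_i c i *: ptrace1 (X i).
Proof.
rewrite ptrace1E; under eq_bigr do rewrite blk_sum.
rewrite exchange_big; apply: eq_bigr => i _ /=.
by rewrite ptrace1E scaler_sumr; apply: eq_bigr => x _; rewrite blkZ.
Qed.

Section Bound.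
Variables (d k : nat) (p : R).
Hypothesis d2 : (2 <= d)%N.
Hypothesis hp : 0 <= p <= d%:R ^+ 2 / (d%:R ^+ 2 - 1).
Variable Omega : 'M[C]_k -> 'M[C]_k.
Hypothesis hOmega : channel Omega.

Let T := ({ffun 'I_d -> 'Z_3} * 'I_d)%type.
Let q : R := (#|{ffun 'I_d -> 'Z_3}|%:R * d%:R)^-1.
Let d0 : (0 < d)%N. Proof. exact: leq_trans d2. Qed.
Let dneq0 : (d%:R : R) != 0. Proof. by rewrite pnatr_eq0 -lt0n. Qed.
Let Nneq0 : #|{ffun 'I_d -> 'Z_3}|%:R != 0 :> R.
Proof. by rewrite pnatr_eq0 -lt0n; apply/card_gt0P; exists 0. Qed.

(** The spectral decomposition of [A] into pure states is one candidate, and all pure states have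
    the same output spectrum up to order. *)
Lemma H_depolarizing_le (A : 'M[C]_d) : density A ->
  H_chan (depolarizing d p) A <= shannon (depol_spectrum (d := d) (1 - p)).
Proof.
move=> hA; have [l0 l1] := density_eigval hA.
have [/psd_eigdec[[hU eA] _] _] := hA; set U := spectralmx A in hU eA.
have -> : shannon (depol_spectrum (d := d) (1 - p)) =
    \sum_x eigval A x *
      vN_entropy (depolarizing d p (adjmx (row x U) *m row x U)).
  under eq_bigr do rewrite (vN_depolarizing_pure d2 hp) //.
  by rewrite -mulr_suml l1 mul1r.
apply: H_chan_le => //.
- by move=> B; exact: vN_depolarizing_ge0.
- move=> x; split.
    by have := psd_mul_adj (adjmx (row x U)); rewrite adjmxK.
  rewrite mxtrace_mulC /mxtrace big_ord1.
  have := congr1 (fun M : 'M_d => M x x) hU; rewrite /= !mxE eqxx mulr1n => <-.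
  by apply: eq_bigr => j _; rewrite !adjmxE !mxE.
- rewrite {1}eA; apply/matrixP => a b; rewrite -mulmxA mxE summxE.
  apply: eq_bigr => x _; rewrite real_diag_mulmxE !mxE big_ord1 !adjmxE !mxE.
  by rewrite mulrCA.
Qed.

(** The [tau t] are normalised slices of [rho] along the twisted Fourier bases, taken after rotating
    [Tr_K rho] to diagonal form. Unbiasedness gives them trace one, and completeness of each basis
    makes them average to [Tr_H rho]. *)
Lemma tensor_depolarizing_decomposition (rho : 'M[C]_(d * k)) : density rho ->
  exists tau : T -> 'M[C]_k,
    [/\ forall t, density (tau t),
        ptrace1 rho = \sum_t RtoC q *: tau t &
        shannon (depol_spectrum (d := d) (1 - p)) +
          \sum_t q * vN_entropy (Omega (tau t)) <=
        vN_entropy (tensor_map (depolarizing d p) Omega rho)].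
Proof.
move=> hrho; have [hl hcp htp] := hOmega.
have [w hw] := prim_root_existsC R d0.
have [z hz] := prim_root_existsC R (isT : (0 < 3)%N).
have lam1 := depol_parameter_le1 hp; have lam0 := depol_parameter_ge d2 hp.
set lam := 1 - p in lam1 lam0 *.
pose sigma := tensor_map (@id 'M[C]_d) Omega rho.
have hsigma : density sigma.
  split; first exact: (hcp d rho (proj1 hrho)).
  by rewrite tensor_id_trace // (proj2 hrho).
have [[hU eh] _] := psd_eigdec (proj1 (ptrace2_density hrho)).
have [_ l1] := density_eigval (ptrace2_density hrho).
set U := spectralmx _ in hU eh; set h := eigval _ in eh l1.
pose b (t : T) := twisted_fourier w z t.1 t.2.
exists (fun t => RtoC d%:R *: contract (b t) (rotate U rho)).
have hrot := rotate_density hU hrho; split.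
- move=> t; split.
    by apply: psdZ; [rewrite RtoC_ge0 ler0n|exact: contract_psd (proj1 hrot)].
  rewrite mxtraceZ contract_trace ptrace2_rotate // eh.
  rewrite -[U *m _ *m _]/(U *m (adjmx U *m real_diag h *m U) *m adjmx U).
  rewrite (eigdec_diag (conj hU (erefl _))).
  transitivity (RtoC d%:R * \sum_x RtoC d%:R^-1 * RtoC (h x)).
    congr (_ * _); apply: eq_bigr => x _.
    rewrite (bigD1 x) //= [X in _ + X]big1 ?addr0 => [|y yx].
      by rewrite real_diagE eqxx mulr1n /b twisted_fourier_norm.
    by rewrite real_diagE eq_sym (negPf yx) mulr0n mulr0.
  by rewrite -mulr_sumr -RtoC_sum l1 RtoC1 mulr1 -RtoCM mulfV.
- rewrite -(ptrace1_rotate hU) ptrace1E.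
  under [RHS]eq_bigr do rewrite scalerA.
  rewrite -(pair_bigA _ (fun D i => (RtoC q * RtoC d%:R) *:
    contract (twisted_fourier w z D i) (rotate U rho))) /=.
  have colsum D : \sum_i contract (twisted_fourier w z D i) (rotate U rho) =
      \sum_x blk (rotate U rho) x x.
    rewrite /contract exchange_big; apply: eq_bigr => x _ /=.
    rewrite exchange_big (bigD1 x) //= [X in _ + X]big1 ?addr0 => [|y yx].
      rewrite -scaler_suml; under eq_bigr do rewrite mulrC.
      by rewrite (twisted_fourier_cols d2 hw hz) eqxx scale1r.
    rewrite -scaler_suml; under eq_bigr do rewrite mulrC.
    by rewrite (twisted_fourier_cols d2 hw hz) (negPf yx) scale0r.
  under [RHS]eq_bigr do rewrite -scaler_sumr colsum.
  rewrite sumr_const -scaler_nat scalerA -RtoC_nat -!RtoCM.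
  rewrite (_ : _ * _ = 1) ?RtoC1 ?scale1r // /q; field.
  by rewrite dneq0 Nneq0.
(* The rotation commutes with the depolarizing map and preserves the entropy; slicing commutes with
   [Omega], which acts on the other factor. *)
- rewrite tensor_depolarizing // -/lam -/sigma.
  rewrite -(vN_rotate hU);
    last exact: (depolarize1_psd d2 hw hz lam1 lam0 (proj1 hsigma)).
  rewrite (rotate_depolarize1 hU).
  have := vN_depolarize1 d2 hw hz lam1 lam0 (rotate_density hU hsigma).
  apply: le_trans; rewrite lerD2l; apply: ler_sum => t _; rewrite -/q.
  rewrite -/(b t) (linear_mapZ hl) !contract_rotate.
  by rewrite contract_tensor_id.
Qed.

End Bound.
End ConvexRoof.

Theorem theorem7 (R : realType) (d k : nat) (p : R)
  (hd : (2 <= d)%N)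
  (hp : 0 <= p <= (d%:R ^+ 2) / (d%:R ^+ 2 - 1))
  (Omega : 'M[R[i]]_k -> 'M[R[i]]_k) (hOmega : channel Omega)
  (rho : 'M[R[i]]_(d * k)) (hrho : density rho) :
  H_chan (tensor_map (depolarizing d p) Omega) rho >=
    H_chan (depolarizing d p) (ptrace2 rho) + H_chan Omega (ptrace1 rho).
Proof.
apply: lb_le_inf.
  (* The trivial decomposition shows that the infimum is over a nonempty set. *)
  exists (\sum_(i : 'I_1) 1 *
    vN_entropy (tensor_map (depolarizing d p) Omega rho)).
  apply: (@out_entropy_values_fin _ _ _ _ _ _ (fun=> 1) (fun=> rho)) => //.
    by rewrite big_ord1.
  by rewrite big_ord1 RtoC1 scale1r.
move=> x [J [pi [ss [pi0 pi1 hss erho ->]]]].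
have /choice[tau htau] := fun j =>
  tensor_depolarizing_decomposition hd hp hOmega (hss j).
set q : R := (_ * _)^-1 in htau.
set S := shannon _ in htau.
have q0 : 0 <= q by rewrite invr_ge0 mulr_ge0 // ler0n.
pose T := ({ffun 'I_d -> 'Z_3} * 'I_d)%type.
have q1 : \sum_(t : T) q = 1.
  rewrite sumr_const card_prod card_ord -mulr_natl /q natrM mulfV //.
  rewrite mulf_neq0 // pnatr_eq0 -lt0n; last exact: leq_trans hd.
  by apply/card_gt0P; exists 0.
(* Splitting every [ss j] further gives a decomposition of [Tr_H rho] into the [tau j t] with
   weights [pi j * q]. *)
have hO : H_chan Omega (ptrace1 rho) <=
    \sum_(jt : 'I_J * T) (pi jt.1 * q) * vN_entropy (Omega (tau jt.1 jt.2)).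
  apply: (@H_chan_le R _ _ Omega _ _ (fun jt : 'I_J * T => pi jt.1 * q)
    (fun jt => tau jt.1 jt.2)).
  - by move=> A hA; apply: vN_entropy_ge0; exact: channel_density.
  - by move=> jt; rewrite mulr_ge0.
  - rewrite -(pair_bigA _ (fun j (t : T) => pi j * q)) /= -pi1.
    by apply: eq_bigr => j _; rewrite -mulr_sumr q1 mulr1.
  - by move=> jt; have [] := htau jt.1.
  - rewrite erho ptrace1_sum -(pair_bigA _ (fun j (t : T) =>
      RtoC (pi j * q) *: tau j t)) /=.
    apply: eq_bigr => j _; have [_ -> _] := htau j.
    by rewrite scaler_sumr; apply: eq_bigr => t _; rewrite scalerA RtoCM.
apply: (@le_trans _ _ (S + \sum_(jt : 'I_J * T) (pi jt.1 * q) *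
    vN_entropy (Omega (tau jt.1 jt.2)))).
  apply: lerD => //; apply: H_depolarizing_le => //; exact: ptrace2_density.
rewrite -(pair_bigA _ (fun j (t : T) => (pi j * q) *
    vN_entropy (Omega (tau j t)))) /=.
(* [S] is distributed over the weights [pi j], which reduces the claim to the bound for each
   [ss j]. *)
rewrite -[S]mul1r -pi1 mulr_suml -big_split; apply: ler_sum => j _ /=.
have [_ _ h] := htau j.
have -> : \sum_(t : T) (pi j * q) * vN_entropy (Omega (tau j t)) =
    pi j * \sum_(t : T) q * vN_entropy (Omega (tau j t)).
  by rewrite mulr_sumr; apply: eq_bigr => t _; rewrite mulrA.
by rewrite -mulrDr ler_wpM2l.
Qed.
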